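(* Let $X,Y,Z,K,f,r,s,\alpha$ and $|\cdot|_Z$ be as in the context, and consider the problem $$\min_{u\in X}\ \frac{\|Ku-f\|_Y^r}{r}+\alpha\frac{|u|_Z^s}{s}. \qquad ( * )$$ Assume that $Y$ is smooth of power-type $p$ with $p\le r$, and that the functional $\Phi=\alpha|\cdot|_Z^s/s$ as well as the norm in $Y$ are totally convex. Let $\{u^n\}$ be a sequence generated by the forward-backward splitting iteration described in the context (with this $p$) applied to $F(u)=\|Ku-f\|_Y^r/r$ and $\Phi$. Then $( * )$ has a unique minimizer $u^*$ and $\{u^n\}$ converges to $u^*$ in $X$. If, moreover, for some $q\ge\max\{r,s,2\}$, $|\cdot|_Z^q/q$ is convex of power-type $q$ in the minimizer $u^*$ and $Y$ is convex of power-type $q$, then $u^n\to u^*$ in $X$ with rate $\|u^n-u^*\|_X=\mathcal{O}(n^{(1-p)/q})$.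
   Context: Setting. $X$ is a real reflexive Banach space, $Y$ a real Banach space, $K:X\to Y$ linear and continuous, $f\in Y$, $r>1$, $s\ge1$, $\alpha>0$. $Z$ is a (not necessarily reflexive) Banach space continuously embedded in $X$, and $|\cdot|_Z$ is a semi-norm on $Z$. It is assumed that: (1) $Z=Z_0\oplus Z_1$ (with $Z_0,Z_1$ closed subspaces of $Z$), where $Z_0=\{z\in Z: |z|_Z=0\}$ is closed in $X$ and $|\cdot|_Z$ is equivalent to $\|\cdot\|_Z$ on $Z_1$; (2) $K$ restricted to $Z_0\subset X$ is continuously invertible, i.e. there is $c>0$ with $\|Kz\|_Y\ge c\|z\|_X$ for all $z\in Z_0$. The functional $\Phi(u)=\alpha|u|_Z^s/s$ is extended by $\Phi(u)=\infty$ for $u\in X\setminus Z$, and $\Phi:X\to\mathbb{R}\cup\{\infty\}$ is lower semi-continuous on $X$. Definitions. - $Y$ is smooth of power-type $p\in(1,2]$ if there is $C>0$ such that for all $u,v\in Y$: $\frac{\|v\|_Y^p}{p}-\frac{\|u\|_Y^p}{p}-\langle j_p(u),v-u\rangle\le C\|v-u\|_Y^p$, where $j_p=\partial(\|\cdot\|_Y^p/p)$ is the $p$-duality mapping. For such $p\le r$, $F$ is differentiable and $F'$ is $(p-1)$-Hölder-continuous on each bounded set of $X$. - $\Phi=\alpha|\cdot|_Z^s/s$ is totally convex if for each $z^*\in Z$, each sequence $\{z^n\}$ in $Z$ and each $\zeta\in\partial\Phi(z^* )$ (subdifferential on $Z$): $\alpha\frac{|z^n|_Z^s}{s}-\alpha\frac{|z^*|_Z^s}{s}-\langle\zeta,z^n-z^*\rangle\to0$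 implies $|z^n-z^*|_Z\to0$. - The norm in $Y$ is totally convex if the functional $\|\cdot\|_Y^r/r$ is totally convex in each $y^*\in Y$, i.e. for each $w\in\partial(\|\cdot\|_Y^r/r)(y^* )$ and each sequence $\{y^n\}$ in $Y$: $\frac{\|y^n\|_Y^r}{r}-\frac{\|y^*\|_Y^r}{r}-\langle w,y^n-y^*\rangle\to0$ implies $\|y^n-y^*\|_Y\to0$. - $|\cdot|_Z^q/q$ is convex of power-type $q$ in $z^*\in Z$ if for each $M>0$ and $\zeta\in\partial(|\cdot|_Z^q/q)(z^* )$ there is $c>0$ such that for all $z\in Z$ with $\|z-z^*\|_Z\le M$: $\frac{|z|_Z^q}{q}-\frac{|z^*|_Z^q}{q}-\langle\zeta,z-z^*\rangle\ge c|z-z^*|_Z^q$. - A Banach space $Y$ is convex of power-type $q$ if its modulus of convexity $\delta_Y(\varepsilon)=\inf\{1-\|\tfrac{x+y}{2}\|_Y:\|x\|_Y=\|y\|_Y=1,\ \|x-y\|_Y\ge\varepsilon\}$ satisfies $\delta_Y(\varepsilon)\ge c\,\varepsilon^q$ for some $c>0$ and all $\varepsilon\in(0,2]$. Iteration. Fix $0<\delta<1$ and $\underline\tau>0$, and start with $u^0\in X$, $\Phi(u^0)<\infty$. Given $u^n$, let $L_n>0$ be a $(p-1)$-Hölder constant of $F'$ (i.e. $\|F'(u)-F'(v)\|_{X^*}\le L_n\|u-v\|_X^{p-1}$) on a ball $\{\|u\|_X\le C_n\}$ such that $\|u\|_X\le C_n$ for all $u$ with $(F+\Phi)(u)\le(F+\Phi)(u^n)$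 (one may keep $L_n=L_{n-1}$). Set $w^n=F'(u^n)$, choose $\tau_n$ with $0<\underline\tau\le\tau_n\le p(1-\delta)/L_n$, and let $u^{n+1}$ be a solution of $$\min_{v\in X}\ \frac{\|v-u^n\|_X^p}{p}+\tau_n\bigl(\langle w^n,v\rangle+\Phi(v)\bigr)$$ which minimizes $\|v-u^n\|_X$ among all solutions $v$. (Stopping at an optimal iterate corresponds to the sequence staying constant from then on.) *)

(* Defs.v *)
From HB Require Import structures.
From mathcomp Require Import all_boot all_order all_algebra.
From mathcomp Require Import all_classical all_reals all_analysis.

Set Implicit Arguments.
Unset Strict Implicit.
Unset Printing Implicit Defensive.

Import Order.TTheory GRing.Theory Num.Theory.
Import numFieldNormedType.Exports.

Local Open Scope classical_set_scope.
Local Open Scope ring_scope.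

Section Dual.
Context {R : realType} {V : normedModType R}.

Definition cont_linear : {pred V -> R} :=
  mem [set f : V -> R | linear f /\ continuous f].

Record dual := Dual { dual_fun :> V -> R; _ : dual_fun \in cont_linear }.

HB.instance Definition _ := [isSub for dual_fun].
HB.instance Definition _ := [Choice of dual by <:].

Lemma cont_linear_submod : submod_closed cont_linear.
Proof.
split.
  rewrite inE; split; last by move=> x; exact: cvg_cst.
  by move=> a x y; rewrite -[LHS]/0 -[RHS]/(a * 0 + 0) mulr0 addr0.
move=> a f g; rewrite !inE => -[lf cf] [lg cg]; split.
  move=> b x y; rewrite !fctE lf lg !scalerDr !scalerA [a * b]mulrC -!addrA.
  by congr (_ + _); rewrite addrCA.
by move=> x; apply: cvgD; [apply: cvgZl_tmp; exact: cf | exact: cg].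
Qed.

HB.instance Definition _ := GRing.isSubmodClosed.Build _ _ cont_linear
  cont_linear_submod.
HB.instance Definition _ := [SubChoice_isSubLmodule of dual by <:].

Lemma dual_linear (f : dual) : linear f.
Proof. by case: f => f /= /[1!inE] -[]. Qed.

Lemma dual_continuous (f : dual) : continuous f.
Proof. by case: f => f /= /[1!inE] -[]. Qed.

HB.instance Definition _ (f : dual) :=
  GRing.isLinear.Build R V R _ (f : V -> R) (@dual_linear f).

Definition dual_norm (f : dual) : R :=
  sup [set `|f x| | x in [set x : V | `|x| <= 1]].

Lemma dual_norm_has_sup (f : dual) :
  has_sup [set `|f x| | x in [set x : V | `|x| <= 1]].
Proof.
split; first by exists `|f 0|, 0 => //=; rewrite normr0 ler01.
have /continuous_linear_bounded /linear_boundedP : {for 0, continuous f}.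
  exact: dual_continuous.
move=> /pinfty_ex_gt0 [M M0 fM]; exists M => _ [x /= x1 <-].
by rewrite (le_trans (fM x))// ger_pMr.
Qed.

Lemma dual_norm_ub (f : dual) x : `|x| <= 1 -> `|f x| <= dual_norm f.
Proof.
by move=> x1; apply: ub_le_sup; [case: (dual_norm_has_sup f)|exists x].
Qed.

Lemma dual_norm_ge0 (f : dual) : 0 <= dual_norm f.
Proof. by rewrite (le_trans _ (@dual_norm_ub f 0 _))// normr0 ler01. Qed.

Lemma dual_norm_le (f : dual) M :
  (forall x, `|x| <= 1 -> `|f x| <= M) -> dual_norm f <= M.
Proof.
move=> fM; apply: ge_sup; first by case: (dual_norm_has_sup f).
by move=> _ [x /= x1 <-]; exact: fM.
Qed.

Lemma dual_normD (f g : dual) : dual_norm (f + g) <= dual_norm f + dual_norm g.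
Proof.
apply: dual_norm_le => x x1.
by rewrite (le_trans (ler_normD _ _))// lerD// dual_norm_ub.
Qed.

Let dual_normZ_le (a : R) (f : dual) :
  dual_norm (a *: f) <= `|a| * dual_norm f.
Proof.
apply: dual_norm_le => x x1.
by rewrite -[(a *: f) x]/(a * f x) normrM ler_wpM2l// dual_norm_ub.
Qed.

Lemma dual_normZ (a : R) (f : dual) : dual_norm (a *: f) = `|a| * dual_norm f.
Proof.
apply/eqP; rewrite eq_le dual_normZ_le /=.
have [->|a0] := eqVneq a 0; first by rewrite normr0 mul0r dual_norm_ge0.
rewrite -ler_pdivlMl ?normr_gt0// -normfV.
by rewrite (le_trans _ (dual_normZ_le _ _))// scalerA mulVf// scale1r.
Qed.

Lemma dual_norm_eq0 (f : dual) : dual_norm f = 0 -> f = 0.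
Proof.
move=> f0; apply/val_inj/funext => x /=.
have [->|x0] := eqVneq x 0; first by rewrite linear0.
have := @dual_norm_ub f (`|x|^-1 *: x).
rewrite f0 normrZ normfV normr_id mulVf ?normr_eq0// => /(_ (lexx _)).
rewrite normr_le0 linearZ /= scaler_eq0 invr_eq0 normr_eq0 (negbTE x0) /=.
by move/eqP.
Qed.

HB.instance Definition _ := Lmodule_isNormed.Build R dual
  dual_normD dual_normZ dual_norm_eq0.

End Dual.
Arguments dual {R} V.

Definition reflexive_space (R : realType) (X : normedModType R) : Prop :=
  forall G : dual (dual X), exists x : X, forall xi : dual X, G xi = xi x.

Section ConvexNotions.
Context {R : realType} {V : normedModType R}.

Definition subdifferential (g : V -> R) (v : V) : set (dual V) :=
  [set xi | forall w, g v + xi (w - v) <= g w].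

(* The set-valued form of $j_p$ is used: under this condition it is
   single-valued, and it is nonempty everywhere by Hahn-Banach. *)
Definition smooth_power_type (p : R) : Prop :=
  exists2 C : R, 0 < C &
  forall (u v : V) (j : dual V),
    subdifferential (fun y => `|y| `^ p / p) u j ->
    `|v| `^ p / p - `|u| `^ p / p - j (v - u) <= C * `|v - u| `^ p.

Definition totally_convex (g N : V -> R) : Prop :=
  forall (vstar : V) (v : nat -> V) (zeta : dual V),
    subdifferential g vstar zeta ->
    g (v n) - g vstar - zeta (v n - vstar) @[n --> \oo] --> (0 : R) ->
    N (v n - vstar) @[n --> \oo] --> (0 : R).

Definition convex_power_type_at (q : R) (N : V -> R) (vstar : V) : Prop :=
  forall (M : R) (zeta : dual V), 0 < M ->
    subdifferential (fun v => N v `^ q / q) vstar zeta ->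
    exists2 c : R, 0 < c &
    forall v, `|v - vstar| <= M ->
      c * N (v - vstar) `^ q <=
        N v `^ q / q - N vstar `^ q / q - zeta (v - vstar).

(* Valued in the extended reals because the infimum is taken over the empty
   set when V is trivial. *)
Definition modulus_of_convexity (eps : R) : \bar R :=
  ereal_inf [set (1 - `|2^-1 *: (xy.1 + xy.2)|)%:E | xy in
    [set xy : V * V | [/\ `|xy.1| = 1, `|xy.2| = 1 & eps <= `|xy.1 - xy.2|]]].

Definition convex_power_type (q : R) : Prop :=
  exists2 c : R, 0 < c &
  forall eps, 0 < eps <= 2 ->
    ((c * eps `^ q)%:E <= modulus_of_convexity eps)%E.

Definition is_seminorm (N : V -> R) : Prop :=
  [/\ forall v, 0 <= N v,
      forall (a : R) v, N (a *: v) = `|a| * N v &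
      forall v w, N (v + w) <= N v + N w].

Definition closed_subspace (A : set V) : Prop :=
  [/\ A 0, forall (a : R) v w, A v -> A w -> A (a *: v + w) & closed A].

Definition direct_sum (A B : set V) : Prop :=
  (forall v, exists a b, [/\ A a, B b & v = a + b]) /\ A `&` B = [set 0].

End ConvexNotions.
Arguments smooth_power_type {R} V p.
Arguments convex_power_type {R} V q.

Definition argmin {R : realType} {T : Type} (G : T -> \bar R) : set T :=
  [set u | forall v, (G u <= G v)%E].

Definition discrepancy {R : realType} {X Y : normedModType R}
    (K : X -> Y) (f : Y) (r : R) (u : X) : R :=
  `|K u - f| `^ r / r.

(* The space Z is viewed in X through the injection iota, so the infimum is
   over at most one point, and it is +oo off the range of iota. *)
Definition penalty {R : realType} {X Z : normedModType R}
    (iota : Z -> X) (N : Z -> R) (s alpha : R) (u : X) : \bar R :=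
  ereal_inf [set (alpha * (N z `^ s / s))%:E | z in [set z | iota z = u]].

Lemma penalty_iota {R : realType} {X Z : normedModType R}
    (iota : Z -> X) (N : Z -> R) (s alpha : R) (z : Z) : injective iota ->
  penalty iota N s alpha (iota z) = (alpha * (N z `^ s / s))%:E.
Proof.
move=> inj; rewrite /penalty [X in ereal_inf X](_ : _ =
  [set (alpha * (N z `^ s / s))%:E]); first exact: ereal_inf1.
by apply/seteqP; split=> [_ [y /= /inj -> <-]//|_ /= ->]; exists z.
Qed.

Lemma penalty_pinfty {R : realType} {X Z : normedModType R}
    (iota : Z -> X) (N : Z -> R) (s alpha : R) (u : X) :
  ~ range iota u -> penalty iota N s alpha u = +oo%E.
Proof.
move=> Nu; rewrite /penalty [X in ereal_inf X](_ : _ = set0).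
  exact: ereal_inf0.
by apply/seteqP; split=> [_ [z /= zu _]|//]; apply: Nu; exists z.
Qed.

Section Splitting.
Context {R : realType} {X : normedModType R}.

(* Total: it is the zero functional where 'd F u is not continuous. *)
Definition frechet (F : X -> R) (u : X) : dual X := insubd 0 ('d F u : X -> R).

Lemma frechetE (F : X -> R) (u : X) :
  differentiable F u -> frechet F u = 'd F u :> (X -> R).
Proof.
move=> dF; apply: insubdK; rewrite inE; split; last exact: diff_continuous.
by move=> a x y; rewrite linearP.
Qed.

Definition objective (F : X -> R) (Phi : X -> \bar R) (u : X) : \bar R :=
  ((F u)%:E + Phi u)%E.

Definition holder_on (A : set X) (L beta : R) (G : X -> dual X) : Prop :=
  forall u v, A u -> A v -> `|G u - G v| <= L * `|u - v| `^ beta.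

Definition step_objective (p tau : R) (w : dual X) (Phi : X -> \bar R)
    (u v : X) : \bar R :=
  ((`|v - u| `^ p / p)%:E + tau%:E * ((w v)%:E + Phi v))%E.

(* No stopping rule is needed: once u n is optimal it solves its own step
   problem at distance 0, so the sequence is constant from there on. *)
Record forward_backward (p delta tau0 : R) (F : X -> R) (Phi : X -> \bar R)
    (C L tau : nat -> R) (u : nat -> X) : Prop := {
  fb_init : (Phi (u 0%N) < +oo)%E ;
  fb_ball : forall n v,
    (objective F Phi v <= objective F Phi (u n))%E -> `|v| <= C n ;
  fb_const_gt0 : forall n, 0 < L n ;
  fb_const : forall n,
    holder_on [set v | `|v| <= C n] (L n) (p - 1) (frechet F) ;
  fb_stepsize : forall n, tau0 <= tau n <= p * (1 - delta) / L n ;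
  fb_step : forall n,
    argmin (step_objective p (tau n) (frechet F (u n)) Phi (u n)) (u n.+1) ;
  fb_closest : forall n v,
    argmin (step_objective p (tau n) (frechet F (u n)) Phi (u n)) v ->
    `|u n.+1 - u n| <= `|v - u n| }.

End Splitting.

(* Main.v *)
Require Import Defs.
From HB Require Import structures.
From mathcomp Require Import all_boot all_order all_algebra.
From mathcomp Require Import all_classical all_reals all_analysis.
From mathcomp Require Import ring lra.

Set Implicit Arguments.
Unset Strict Implicit.
Unset Printing Implicit Defensive.

Import Order.TTheory GRing.Theory Num.Theory.
Import numFieldNormedType.Exports.

Local Open Scope classical_set_scope.
Local Open Scope ring_scope.

(* The proof compares Bregman distances with the gap
   [r n = (F + Phi) (u n) - min (F + Phi)] in the objective.

   Each step decreases the gap by at least [delta * D n], where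
   [D n = Phi (u n) - Phi (u n.+1) + F'(u n) (u n - u n.+1)]. Testing the
   minimality of [u n.+1] on the segment from [u n] to the minimizer bounds
   [D n] below by a multiple of [r n `^ (p / (p - 1))], whence
   [r n = O(n `^ (1 - p))].

   At the minimizer [zstar], [r n] splits into the Bregman distances of [Phi]
   and of the norm power of [Y]; both tend to zero, so total convexity gives
   [N (z n - zstar) --> 0] and [K (u n - iota zstar) --> 0], and these two
   quantities control the norm of [X]. Under convexity of power-type [q] the
   same Bregman distances dominate the [q]-th powers of these quantities near
   [zstar], which yields the rate.

   A minimizer exists because, in a reflexive space, a decreasing sequence of
   nonempty bounded closed convex sets [A k] has a common point: any linear
   functional on the dual dominated by [xi |-> inf_k sup_(A k) xi] is the
   evaluation at such a point. *)

(** About [F] the iteration uses its subgradient inequality, a first-order expansion from above and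
    the Hoelder constants [L n]. The first two are read off a norming functional of [K u - f], and
    together they identify the derivative; smoothness of [Y] yields the expansion, while the
    quantitative descent comes from [L n].

    The obstacle for the rate is that power-type convexity is assumed for [N^q] and for the unit
    sphere of [Y], whereas the Bregman distances at hand belong to the powers [s] and [r]. They are
    therefore split into a radial and an angular part. The radial part is a Bregman distance of a
    scalar power, which near [1] is comparable to [(x - 1)^2] for every exponent above [1] and so
    dominates [|x - 1|^q] for [q >= 2]. The angular part depends on the exponent only through a
    constant factor, so it passes from one power to the other. *)

(** * Tangents and Bregman distances of real powers *)

Section RealPowers.
Context {R : realType}.
Implicit Types a b t x y : R.

Lemma ler_powR_base a b t : 0 <= t -> 0 <= a -> a <= b -> a `^ t <= b `^ t.
Proof.
by move=> t0 a0 ab; apply: ge0_ler_powR => //; rewrite nnegrE// (le_trans a0).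
Qed.

(* Young's inequality applied to [a] and [b `^ (t - 1)]. *)
Lemma powR_tangent a b t : 0 <= a -> 0 <= b -> 1 <= t ->
  b `^ t + t * b `^ (t - 1) * (a - b) <= a `^ t.
Proof.
move=> a0 b0; rewrite le_eqVlt => /predU1P[<-|t1].
  by rewrite subrr powRr0 !powRr1//; lra.
have t0 : 0 < t by lra.
have t10 : 0 < t - 1 by lra.
have tt0 : 0 < t / (t - 1) by rewrite divr_gt0.
have tn0 : t != 0 by rewrite gt_eqF.
have := @conjugate_powR R a (b `^ (t - 1)) t (t / (t - 1)) a0 (powR_ge0 _ _) t0 tt0.
rewrite invf_div -powRrM.
have -> : (t - 1) * (t / (t - 1)) = t by field; rewrite gt_eqF.
have -> : t^-1 + (t - 1) / t = 1 by field.
move=> /(_ erefl) /(ler_wpM2l (ltW t0)).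
have -> : t * (a `^ t / t + b `^ t * ((t - 1) / t)) = a `^ t + b `^ t * (t - 1).
  by field.
have := mulr_powRB1 b0 t0; set B := b `^ (t - 1) => <-; nra.
Qed.

(** For [t >= 1] the tangents at [1] and at [x] enclose the ratio. An exponent below [1] belongs to
    the inverse function of a power with exponent above [1], so its ratio is a reciprocal. Both
    cases occur, since the exponent used below is [t - 1] with [t > 1]. *)
Lemma powR_sub1_ratio t : 0 < t -> exists c C : R, [/\ 0 < c, 0 < C &
  forall x, 2^-1 <= x <= 2 ->
    exists2 k : R, c <= k <= C & x `^ t - 1 = k * (x - 1)].
Proof.
wlog t1 : t / 1 <= t => [hw|].
  have [/hw//|t1 t0] := leP 1 t.
  have ti : 1 <= t^-1 by rewrite invf_ge1// ltW.
  have [c [C [c0 C0 hC]]] := hw _ ti (lt_le_trans ltr01 ti).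
  exists C^-1, c^-1; split; rewrite ?invr_gt0// => x /andP[x1 x2].
  have x0 : 0 < x by lra.
  (* An exponent below [1] moves [x] towards [1], so the interval is preserved. *)
  have yb : 2^-1 <= x `^ t <= 2.
    apply/andP; split.
      have [x1'|x1'] := leP x 1.
        by rewrite (le_trans x1)// ger1_powR ?x0// ltW.
      by rewrite (@le_trans _ _ 1)//; [lra|rewrite -(powRr0 x) ler_powR// ltW].
    have [x1'|x1'] := leP x 1.
      rewrite (@le_trans _ _ 1)//; last by lra.
      by rewrite -(powRr0 x) ger_powR ?x0// ltW.
    by rewrite (le_trans _ x2)// ler1_powR// ltW.
  have [k /andP[ck kC]] := hC _ yb.
  rewrite -powRrM mulfV ?gt_eqF// powRr1 ?ltW// => hk.
  have k0 : 0 < k by lra.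
  exists k^-1; first by rewrite !lef_pV2 ?posrE// ck kC.
  by rewrite hk mulKf// gt_eqF.
move=> t0; exists (t * 2^-1 `^ (t - 1)), (t * 2 `^ (t - 1)).
have t10 : 0 <= t - 1 by lra.
split; rewrite ?mulr_gt0 ?powR_gt0// => x /andP[x1 x2].
have x0 : 0 < x by lra.
have P1 : 2^-1 `^ (t - 1) <= 1.
  have := @ler_powR_base 2^-1 1 _ t10 ltac:(lra) ltac:(lra).
  by rewrite powR1.
have P2 : 1 <= 2 `^ (t - 1) :> R.
  by have := @ler_powR R 2 ltac:(lra) 0 _ t10; rewrite powRr0.
have Px : 2^-1 `^ (t - 1) <= x `^ (t - 1) <= 2 `^ (t - 1).
  by rewrite !ler_powR_base//; lra.
have [->|xn1] := eqVneq x 1.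
  exists t; last by rewrite powR1; lra.
  by rewrite ler_piMr// ?ler_peMr// ltW.
have T1 := powR_tangent (ltW x0) ler01 t1.
have T2 := powR_tangent ler01 (ltW x0) t1.
rewrite !powR1 in T1 T2.
exists ((x `^ t - 1) / (x - 1)); last by rewrite divfK// subr_eq0.
case/andP: Px => Px1 Px2.
move: T1 T2 P1 P2 Px1 Px2; set a := 2^-1 `^ _; set b := 2 `^ _; set c := x `^ (t - 1).
move=> T1 T2 P1 P2 Px1 Px2.
have [x1'|x1'|] := ltgtP x 1; last by move/eqP; rewrite (negbTE xn1).
  rewrite ler_ndivlMr ?ler_ndivrMr ?subr_lt0//.
  have ? : t * a * (1 - x) <= t * c * (1 - x).
    by apply: ler_wpM2r; [lra|apply: ler_wpM2l; lra].
  have ? : t * 1 * (1 - x) <= t * b * (1 - x).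
    by apply: ler_wpM2r; [lra|apply: ler_wpM2l; lra].
  by apply/andP; split; lra.
rewrite ler_pdivlMr ?ler_pdivrMr ?subr_gt0//.
have ? : t * a * (x - 1) <= t * 1 * (x - 1).
  by apply: ler_wpM2r; [lra|apply: ler_wpM2l; lra].
have ? : t * c * (x - 1) <= t * b * (x - 1).
  by apply: ler_wpM2r; [lra|apply: ler_wpM2l; lra].
by apply/andP; split; lra.
Qed.

(* The lower bound compares the tangents at [1] and at the midpoint of [1] and
   [x]. *)
Lemma powR_bregman1 t : 1 < t -> exists c C : R, [/\ 0 < c, 0 < C &
  forall x, 2^-1 <= x <= 2 ->
    c * (x - 1) ^+ 2 <= (x `^ t - 1) / t - (x - 1) <= C * (x - 1) ^+ 2].
Proof.
move=> t1; have t0 : 0 < t by lra.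
have tn0 : t != 0 by rewrite gt_eqF.
have t10 : 0 < t - 1 by lra.
have [c [C [c0 C0 hk]]] := powR_sub1_ratio t10.
(* The two tangents leave [t * (m^(t-1) - 1) * (x - 1) / 2], and [m - 1] is again half of [x - 1];
   hence the factor [4]. *)
exists (c / 4), C; split=> [|//|x /andP[x1 x2]]; first by rewrite divr_gt0.
pose m := (1 + x) / 2.
have xE : x = 2 * m - 1 by rewrite /m; lra.
have [k /andP[ck kC] hx] := hk x ltac:(lra).
have [l /andP[cl lC] hm] := hk m ltac:(rewrite /m; lra).
have x0 : 0 <= x by lra.
have m0 : 0 <= m by rewrite /m; lra.
have A1 := powR_tangent ler01 x0 (ltW t1).
have A2 := powR_tangent x0 m0 (ltW t1).
have A3 := powR_tangent m0 ler01 (ltW t1).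
rewrite !powR1 in A1 A3.
have {}hx : x `^ (t - 1) = 1 + k * (x - 1) by rewrite -hx; lra.
have {}hm : m `^ (t - 1) = 1 + l * (m - 1) by rewrite -hm; lra.
have -> : (x `^ t - 1) / t - (x - 1) = (x `^ t - 1 - t * (x - 1)) / t by field.
rewrite ler_pdivrMr// ler_pdivlMr//.
rewrite hx in A1; rewrite hm in A2.
have D0 : 0 <= (x - 1) ^+ 2 := sqr_ge0 _.
have ? : 0 <= t * (l - c) * (x - 1) ^+ 2.
  by rewrite mulr_ge0// mulr_ge0 ?subr_ge0// ltW.
have ? : 0 <= t * (C - k) * (x - 1) ^+ 2.
  by rewrite mulr_ge0// mulr_ge0 ?subr_ge0// ltW.
move: A1 A2 A3; set Xt := x `^ t; set Mt := m `^ t => A1 A2 A3.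
apply/andP; split; rewrite xE in A1 A2 *; nra.
Qed.

End RealPowers.

(** * Hahn-Banach theorem by minimal sublinear functionals *)

Section HahnBanach.
Context {R : realType} {V : lmodType R}.
Implicit Types (p q : V -> R) (x y : V).

Definition sublinear p : Prop :=
  (forall x y, p (x + y) <= p x + p y) /\
  (forall (a : R) x, 0 <= a -> p (a *: x) = a * p x).

Lemma sublinear0 p : sublinear p -> p 0 = 0.
Proof. by move=> [_ /(_ 0 0 (lexx _))]; rewrite scale0r mul0r. Qed.

Lemma sublinear_geN p x : sublinear p -> - p (- x) <= p x.
Proof.
by move=> sp; rewrite -subr_ge0 opprK -(sublinear0 sp) -(subrr x); case: sp.
Qed.

(** One criterion for all the infima formed below. The members of the family need not be sublinear:
    both laws may hold only after a change of index, which covers chains, decreasing sets and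
    families of translates. *)
Lemma sublinear_inf {I : Type} (A : set I) (g : I -> V -> R) : A !=set0 ->
  (forall x, exists m : R, forall i, A i -> m <= g i x) ->
  (forall i j x y, A i -> A j ->
    exists2 k, A k & g k (x + y) <= g i x + g j y) ->
  (forall (a : R) i x, 0 < a -> A i -> exists2 k, A k & g k (a *: x) <= a * g i x) ->
  sublinear (fun x => inf [set g i x | i in A]).
Proof.
move=> [i0 Ai0] lbg gD gZ; pose P x := inf [set g i x | i in A].
have P_le i x : A i -> P x <= g i x.
  move=> Ai; apply: ge_inf; last by exists i.
  by have [m hm] := lbg x; exists m => _ [j Aj <-]; exact: hm.
have P_ge m x : (forall i, A i -> m <= g i x) -> m <= P x.
  move=> hm; apply: lb_le_inf; first by exists (g i0 x), i0.
  by move=> _ [i Ai <-]; exact: hm.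
have PZ_le a x : 0 < a -> P (a *: x) <= a * P x.
  move=> a0; rewrite -ler_pdivrMl//; apply: P_ge => i Ai; rewrite ler_pdivrMl//.
  by have [k Ak gk] := gZ _ _ x a0 Ai; rewrite (le_trans _ gk)// P_le.
have PZ a x : 0 < a -> P (a *: x) = a * P x.
  move=> a0; apply/eqP; rewrite eq_le PZ_le//= -ler_pdivlMl//.
  have := PZ_le a^-1 (a *: x); rewrite invr_gt0 => /(_ a0).
  by rewrite scalerA mulVf ?gt_eqF// scale1r.
have P0 : P 0 = 0 by have := PZ 2 0; rewrite scaler0 => /(_ ltac:(lra)); lra.
split=> [x y|a x].
  rewrite -/(P (x + y)) -/(P x) -/(P y) -lerBlDr.
  apply: (P_ge) => i Ai; rewrite lerBlDr -lerBlDl.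
  apply: P_ge => j Aj; rewrite lerBlDl.
  by have [k Ak gk] := gD _ _ x y Ai Aj; rewrite (le_trans _ gk)// P_le.
rewrite le_eqVlt -/(P (a *: x)) -/(P x) => /predU1P[<-|/PZ//].
by rewrite scale0r P0 mul0r.
Qed.

(* A minimal sublinear functional [q] is linear, because it coincides with
   [x |-> inf_(t >= 0) (q (x + t y) - t q y)] for every [y]. *)
Lemma minimal_sublinear_linear q : sublinear q ->
  (forall q', sublinear q' -> (forall x, q' x <= q x) -> forall x, q x <= q' x) ->
  linear q.
Proof.
move=> sq minq; have [qD qZ] := sq.
have q_superadd x y : q x + q y <= q (x + y).
  pose g t x := q (x + t *: y) - t * q y.
  pose q' x := inf [set g t x | t in [set t | 0 <= t]].
  have lbg z : exists m, forall t, 0 <= t -> m <= g t z.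
    exists (- q (- z)) => t t0; rewrite /g -qZ//.
    by have := qD (z + t *: y) (- z); rewrite addrAC subrr add0r; lra.
  have sq' : sublinear q'.
    apply: sublinear_inf => //; first by exists 0; rewrite /= lexx.
      move=> t u a b /= t0 u0; exists (t + u); first exact: addr_ge0.
      rewrite /g scalerDl addrACA mulrDl.
      by have := qD (a + t *: y) (b + u *: y); lra.
    move=> a t z a0 t0; exists (a * t); first by rewrite /= mulr_ge0// ltW.
    by rewrite /g -scalerA -scalerDr (qZ _ _ (ltW a0)) mulrBr mulrA.
  have q'_le t z : 0 <= t -> q' z <= g t z.
    move=> t0; apply: ge_inf; last by exists t.
    by have [m hm] := lbg z; exists m => _ [j Aj <-]; exact: hm.
  have q'q z : q' z <= q z.
    by have := q'_le 0 z (lexx _); rewrite /g scale0r addr0 mul0r subr0.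
  (* Minimality gives [q x <= q' x]; the index [1] of the infimum turns this into
     superadditivity. *)
  have := le_trans (minq _ sq' q'q x) (q'_le 1 x ler01).
  by rewrite /g scale1r mul1r lerBrDr.
have qadd x y : q (x + y) = q x + q y.
  by apply/eqP; rewrite eq_le qD q_superadd.
have qN x : q (- x) = - q x.
  by apply/eqP; rewrite -addr_eq0 -qadd addNr (sublinear0 sq).
move=> a x y; rewrite qadd; congr (_ + _).
have [a0|a0] := leP 0 a; first exact: qZ.
by rewrite -[a]opprK scaleNr qN qZ ?oppr_ge0 1?ltW// scaleNr.
Qed.

(** Zorn's lemma runs downwards through the sublinear functionals below [p]. Constraints on [f] are
    meant to be built into [p], as the separation lemma does. *)
Theorem hahn_banach p : sublinear p ->
  exists2 f : V -> R, linear f & forall x, f x <= p x.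
Proof.
move=> sp; pose T := {q : V -> R | sublinear q /\ forall x, q x <= p x}.
have t0 : T by exists p.
(* The order is reversed: maximal for [rle] means pointwise minimal. *)
pose rle (s t : T) := `[< forall x, sval t x <= sval s x >].
have [] := @ZL_preorder T t0 rle.
- by move=> t; apply/asboolP.
- move=> r s t /asboolP rs /asboolP st; apply/asboolP => x.
  exact: le_trans (st x) (rs x).
- move=> A Atot; have [[s0 As0]|A0] := pselect (A !=set0); last first.
    by exists t0 => s As; exfalso; apply: A0; exists s.
  pose q x := inf [set sval t x | t in A].
  have lbA x : exists m, forall t, A t -> m <= sval t x.
    exists (- p (- x)) => -[q' [sq' q'p]] _ /=.
    by rewrite (le_trans _ (sublinear_geN _ sq'))// lerN2.
  have q_le t x : A t -> q x <= sval t x.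
    move=> At; apply: ge_inf; last by exists t.
    by have [m hm] := lbA x; exists m => _ [j Aj <-]; exact: hm.
  have sq : sublinear q.
    apply: (sublinear_inf (g := fun t : T => sval t)) => //; first by exists s0.
      move=> s t x y As At; have [st|ts] := Atot _ _ As At.
        exists t => //; have [tD _] := (svalP t).1.
        by rewrite (le_trans (tD _ _))// lerD2r; move/asboolP : st.
      exists s => //; have [sD _] := (svalP s).1.
      by rewrite (le_trans (sD _ _))// lerD2l; move/asboolP : ts.
    move=> a t x a0 At; exists t => //.
    by have [_ ->//] := (svalP t).1; exact: ltW.
  have qp x : q x <= p x.
    by rewrite (le_trans (q_le _ _ As0))//; exact: (svalP s0).2.
  exists (exist _ q (conj sq qp)) => s As; apply/asboolP => x /=.
  exact: q_le.
move=> [q [sq qp]] qmax; exists q => //; apply: minimal_sublinear_linear => //.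
move=> q' sq' q'q x.
have q'p y : q' y <= p y := le_trans (q'q y) (qp y).
have := qmax (exist _ q' (conj sq' q'p)).
by rewrite /rle /= => /(_ (asboolT q'q))/asboolP; exact.
Qed.

End HahnBanach.

(** * Separation of a point from a convex set *)

Section Separation.
Context {R : realType} {V : normedModType R}.

Lemma dual_of_bounded (f : V -> R) (M : R) : linear f ->
  (forall x, f x <= M * `|x|) -> exists xi : dual V, xi =1 f.
Proof.
move=> lf fM.
pose g : {linear V -> R} := HB.pack f (GRing.isLinear.Build R V R _ f lf).
have cf : continuous g.
  apply/linear_bounded_continuous/linear_boundedP.
  near=> r => x; rewrite ler_norml lerNl -linearN.
  have Mr : M * `|x| <= r * `|x| by rewrite ler_wpM2r//; near: r; exact: nbhs_pinfty_ge.
  by apply/andP; split; rewrite (le_trans (fM _))// normrN.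
have fP : (f : V -> R) \in cont_linear by rewrite inE.
by exists (Dual fP).
Unshelve. all: by end_near. Qed.

Lemma dual_ler_norm (xi : dual V) x : xi x <= `|xi| * `|x|.
Proof.
have [->|x0] := eqVneq x 0; first by rewrite linear0 normr0 mulr0.
have := @dual_norm_ub _ _ xi (`|x|^-1 *: x).
rewrite normrZ normfV normr_id mulVf ?normr_eq0// => /(_ (lexx _)).
rewrite linearZ /= normrM normfV normr_id ler_pdivrMl ?normr_gt0// mulrC.
exact/le_trans/ler_norm.
Qed.

(* Dominated by the sublinear functional
   [v |-> inf_(t >= 0, a in A) (|v - t (a - x)| - t d)]. *)
Lemma dual_separation (A : set V) (x : V) (d : R) : A !=set0 ->
  (forall a b (t : R), A a -> A b -> 0 <= t <= 1 -> A (t *: a + (1 - t) *: b)) ->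
  (forall a, A a -> d <= `|a - x|) ->
  exists2 xi : dual V, forall v, xi v <= `|v| &
    forall a, A a -> xi a <= xi x - d.
Proof.
move=> [a0 Aa0] convA dA.
pose B := [set ta : R * V | 0 <= ta.1 /\ A ta.2].
pose g (ta : R * V) v := `|v - ta.1 *: (ta.2 - x)| - ta.1 * d.
pose P v := inf [set g ta v | ta in B].
have lbg v : exists m, forall ta, B ta -> m <= g ta v.
  exists (- `|v|) => -[t a] [/= t0 Aa]; rewrite /g /=.
  have := ler_distD 0 v (t *: (a - x)); rewrite subr0 sub0r normrN.
  have := ler_wpM2l t0 (dA _ Aa); rewrite -{2}(ger0_norm t0) -normrZ.
  have := ler_distD v 0 (t *: (a - x)); rewrite !sub0r !normrN.
  lra.
have P_le ta v : B ta -> P v <= g ta v.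
  move=> Bta; apply: ge_inf; last by exists ta.
  by have [m hm] := lbg v; exists m => _ [j Aj <-]; exact: hm.
have B0 : B (0, a0) by split => //=.
have sP : sublinear P.
  apply: sublinear_inf => //; first by exists (0, a0).
    move=> [t a] [u b] v w [/= t0 Aa] [/= u0 Ab].
    have [tu0|tu0] := leP (t + u) 0.
      have [-> ->] : t = 0 /\ u = 0 by lra.
      exists (0, a0) => //; rewrite /g /= !scale0r !mul0r !subr0.
      exact: ler_normD.
    exists (t + u, (t / (t + u)) *: a + (1 - t / (t + u)) *: b).
      split => /=; first lra.
      by apply: convA => //; rewrite divr_ge0 ?ler_pdivrMr//=; lra.
    rewrite /g /=.
    have -> : (t + u) *: (t / (t + u) *: a + (1 - t / (t + u)) *: b - x) =
              t *: (a - x) + u *: (b - x).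
      have E1 : (t + u) * (t / (t + u)) = t by field; rewrite gt_eqF.
      have E2 : (t + u) * (1 - t / (t + u)) = u by field; rewrite gt_eqF.
      by rewrite scalerBr scalerDr !scalerA E1 E2 scalerDl !scalerBr opprD addrACA.
    have := ler_normD (v - t *: (a - x)) (w - u *: (b - x)).
    by rewrite addrACA -opprD mulrDl; lra.
  move=> c [t a] v c0 [/= t0 Aa]; exists (c * t, a).
    by split => //=; rewrite mulr_ge0// ltW.
  rewrite /g /= -scalerA -scalerBr normrZ gtr0_norm//.
  by rewrite mulrBr mulrA.
have [f lf fP] := hahn_banach sP.
have f_le v : f v <= `|v|.
  by rewrite (le_trans (fP _))// (le_trans (P_le _ _ B0))// /g /= scale0r mul0r !subr0.
have [v|xi xiE] := @dual_of_bounded f 1 lf; first by rewrite mul1r.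
exists xi => [v|a Aa]; first by rewrite xiE.
(* At [a - x] the index [(1, a)] makes the norm vanish and leaves [- d]. *)
have B1 : B (1, a) by split => /=.
have := le_trans (fP (a - x)) (P_le _ _ B1).
by rewrite -xiE linearB /g /= scale1r subrr normr0; lra.
Qed.

(** Obtained by separating [0] from the single point [- y], which lies at distance [|y|]. Multiplied
    by [|y|^(t-1)], such a [xi] serves as the value of the duality mapping at [y]. *)
Lemma norming_functional (y : V) :
  exists2 xi : dual V, forall v, xi v <= `|v| & xi y = `|y|.
Proof.
have [|||xi xi1 xiy] := @dual_separation [set - y] 0 `|y|.
- by exists (- y).
- by move=> _ _ t -> -> _ /=; rewrite -scalerDl addrC subrK scale1r.
- by move=> _ ->; rewrite subr0 normrN.
exists xi => //; apply/eqP; rewrite eq_le xi1/=.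
by have := xiy _ erefl; rewrite linearN linear0 sub0r lerN2.
Qed.

End Separation.

(** * Nested bounded convex sets in a reflexive space *)

Section Smulian.
Context {R : realType} {X : normedModType R}.

Lemma reflexive_bigcap_nonempty (A : nat -> set X) (M : R) :
  reflexive_space X ->
  (forall n, A n !=set0) -> (forall n, closed (A n)) ->
  (forall n a b (t : R), A n a -> A n b -> 0 <= t <= 1 ->
    A n (t *: a + (1 - t) *: b)) ->
  (forall n, A n.+1 `<=` A n) -> (forall x, A 0%N x -> `|x| <= M) ->
  exists x, forall n, A n x.
Proof.
move=> reflX A0 clA convA decA bndA.
have subA m n : (m <= n)%N -> A n `<=` A m.
  by move=> /subnK <-; elim: (n - m)%N => [|k ih]// x /decA; exact: ih.
have bnd n x : A n x -> `|x| <= M by move=> /(subA 0%N n (leq0n _)); exact: bndA.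
have M0 : 0 <= M by have [a /bnd] := A0 0%N; exact: le_trans.
pose S n (xi : dual X) := sup [set xi x | x in A n].
have xi_le (xi : dual X) n x : A n x -> xi x <= `|xi| * M.
  move=> /bnd xM; rewrite (le_trans (dual_ler_norm _ _))//.
  exact: ler_wpM2l.
have S_ge n (xi : dual X) x : A n x -> xi x <= S n xi.
  move=> Ax; apply: ub_le_sup; last by exists x.
  by exists (`|xi| * M) => _ [y Ay <-]; exact: xi_le Ay.
have S_le n (xi : dual X) m : (forall x, A n x -> xi x <= m) -> S n xi <= m.
  move=> h; have [a Aa] := A0 n; apply: ge_sup; first by exists (xi a), a.
  by move=> _ [y Ay <-]; exact: h.
pose P (xi : dual X) := inf [set S n xi | n in [set: nat]].
have lbS xi : exists m, forall n, [set: nat] n -> m <= S n xi.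
  exists (- (`|xi| * M)) => n _; have [a Aa] := A0 n.
  rewrite (le_trans _ (S_ge _ _ _ Aa))// lerNl.
  have := xi_le (- xi) n a Aa; rewrite normrN; exact: le_trans.
have P_le n xi : P xi <= S n xi.
  apply: ge_inf; last by exists n.
  by have [m hm] := lbS xi; exists m => _ [j Aj <-]; exact: hm.
have sP : sublinear P.
  apply: sublinear_inf => //.
    (* The later of the two sets lies in both, so each summand is below its own supremum. *)
    move=> m n xi eta _ _; exists (maxn m n) => //; apply: S_le => x Ax.
    have Am := subA _ _ (leq_maxl m n) _ Ax.
    have An := subA _ _ (leq_maxr m n) _ Ax.
    by rewrite -[leLHS]/(xi x + eta x) lerD// S_ge.
  move=> a n xi a0 _; exists n => //; apply: S_le => x Ax.
  by rewrite -[leLHS]/(a * xi x) ler_wpM2l ?S_ge// ltW.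
have [G lG GP] := hahn_banach sP.
have [xi|G' G'E] := @dual_of_bounded _ _ G M lG.
  rewrite (le_trans (GP _))// (le_trans (P_le 0%N _))// mulrC.
  by apply: S_le => x; exact: xi_le.
have [x xE] := reflX G'.
exists x => n; apply: contrapT => nAx.
(* If [x] missed [A n], so would a ball around it, and a separating [xi] would satisfy
   [S n xi < xi x], against [G <= P <= S n]. *)
have /nbhs_ballP[d /= d0 dA] : nbhs x (~` A n).
  by apply: open_nbhs_nbhs; split => //; exact: closed_openC.
have [a Aa|xi xi1 xiA] := @dual_separation _ _ _ x d (A0 n) (convA n).
  rewrite leNgt; apply/negP => ax; apply: (dA a) => //.
  by rewrite -ball_normE /= distrC.
have : xi x <= xi x - d.
  rewrite -{1}xE G'E (le_trans (GP _))// (le_trans (P_le n _))//.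
  exact: S_le.
by rewrite lerBrDr gerDl leNgt d0.
Qed.

End Smulian.

Section PowerContinuity.
Context {R : realType}.

(** At [x0 = 0] the power need not be differentiable and continuity is one-sided; hence the explicit
    form over nonnegative [x]. *)
Lemma powR_continuous_at (a x0 : R) : 0 <= a -> 0 <= x0 ->
  forall e : R, 0 < e -> exists2 d : R, 0 < d &
    forall x, 0 <= x -> `|x - x0| <= d -> `|x `^ a - x0 `^ a| <= e.
Proof.
rewrite le_eqVlt => /predU1P[<- _ e e0|a0].
  by exists 1 => // x _ _; rewrite !powRr0 subrr normr0 ltW.
rewrite le_eqVlt => /predU1P[<- e e0|x00 e e0].
  exists (e `^ a^-1); first exact: powR_gt0.
  move=> x xge0; rewrite subr0 ger0_norm// => xe.
  rewrite powR0 ?gt_eqF// subr0 ger0_norm ?powR_ge0//.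
  rewrite (le_trans (ler_powR_base (ltW a0) _ xe))//.
  by rewrite -powRrM mulVf ?gt_eqF// powRr1// ltW.
have /derivable1_diffP/differentiable_continuous : derivable (fun x => x `^ a) x0 1.
  by apply: derivable_powR; rewrite in_itv/= x00.
move=> /cvgrPdist_le/(_ e e0)/nbhs_ballP[d /= d0 hd].
exists (d / 2); first by rewrite divr_gt0.
move=> x xge0 xd; rewrite distrC; apply: hd.
by rewrite -ball_normE /= distrC (le_lt_trans xd)// ltr_pdivrMr// ltr_pMr// ltr1n.
Qed.

End PowerContinuity.

(** * Subgradients and first-order expansion of powers of a norm *)

Section PowerOfNorm.
Context {R : realType} {Y : normedModType R}.

Lemma power_norm_subgradient (y v : Y) (xi : dual Y) (t : R) : 1 <= t ->
  (forall v, xi v <= `|v|) -> xi y = `|y| ->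
  `|y| `^ t / t + `|y| `^ (t - 1) * xi (v - y) <= `|v| `^ t / t.
Proof.
move=> t1 xi1 xiy; have t0 : 0 < t by lra.
have := powR_tangent (normr_ge0 v) (normr_ge0 y) t1.
have -> : xi (v - y) = xi v - `|y| by rewrite -xiy; exact: linearB.
rewrite -(ler_pM2r (_ : 0 < t^-1)) ?invr_gt0// mulrDl.
have -> : t * `|y| `^ (t - 1) * (`|v| - `|y|) / t = `|y| `^ (t - 1) * (`|v| - `|y|).
  by field; rewrite gt_eqF.
apply: le_trans; rewrite lerD2l ler_wpM2l ?powR_ge0//.
by have := xi1 v; lra.
Qed.

Lemma power_norm_subdifferential (y : Y) (xi : dual Y) (t : R) : 1 <= t ->
  (forall v, xi v <= `|v|) -> xi y = `|y| ->
  subdifferential (fun v => `|v| `^ t / t) y (`|y| `^ (t - 1) *: xi).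
Proof. by move=> t1 xi1 xiy v; exact: power_norm_subgradient. Qed.

(* [p = r] is smoothness itself; for [p < r] the tangent of [x `^ (r / p)] at
   [`|v| `^ p] gives [(`|v| `^ r - `|y| `^ r) / r <=
   `|v| `^ (r - p) * (`|v| `^ p - `|y| `^ p) / p]. *)
Lemma smooth_power_norm_expansion (p r : R) (y : Y) (xi : dual Y) :
  smooth_power_type Y p -> 1 < p -> p <= r ->
  (forall v, xi v <= `|v|) -> xi y = `|y| ->
  forall e : R, 0 < e -> exists2 d : R, 0 < d & forall v, `|v - y| <= d ->
    `|v| `^ r / r - `|y| `^ r / r - `|y| `^ (r - 1) * xi (v - y) <= e * `|v - y|.
Proof.
move=> [C C0 smoothY] p1 pr xi1 xiy e e0.
have p0 : 0 < p by lra.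
have r0 : 0 < r by lra.
have p10 : 0 < p - 1 by lra.
have rp0 : 0 <= r - p by lra.
pose J := `|y| `^ (p - 1).
have J0 : 0 <= J := powR_ge0 _ _.
pose M := (`|y| + 1) `^ (r - p).
have M0 : 0 <= M := powR_ge0 _ _.
(* Two errors share [e]: the variation of [V] near [|y|^(r-p)], controlled by [e1], and the
   remainder of order [p], controlled by [e2]. *)
pose e1 := e / 2 / (J + 1).
have e10 : 0 < e1 by rewrite !divr_gt0//; lra.
pose e2 := e / 2 / (C * M + 1).
have CM0 : 0 < C * M + 1 by rewrite ltr_wpDl// mulr_ge0// ltW.
have e20 : 0 < e2 by rewrite !divr_gt0.
have [d1 d10 hd1] := powR_continuous_at rp0 (normr_ge0 y) e10.
exists (Num.min 1 (Num.min d1 (e2 `^ (p - 1)^-1))).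
  by rewrite !lt_min ltr01 d10 powR_gt0.
move=> v; rewrite !le_min => /and3P[vy1 vyd vye].
have nvy : `| `|v| - `|y| | <= `|v - y| := ler_dist_dist v y.
have v1 : `|v| <= `|y| + 1 by move: nvy; rewrite ler_norml => /andP[_]; lra.
pose V := `|v| `^ (r - p).
have VM : V <= M by apply: ler_powR_base.
have V0 : 0 <= V := powR_ge0 _ _.
have Ve1 : `|V - `|y| `^ (r - p)| <= e1 by apply: hd1 => //; lra.
have T : `|v| `^ r / r - `|y| `^ r / r <= V * (`|v| `^ p / p - `|y| `^ p / p).
  have := @powR_tangent _ (`|y| `^ p) (`|v| `^ p) (r / p) (powR_ge0 _ _) (powR_ge0 _ _).
  rewrite ler_pdivlMr// mul1r => /(_ pr).
  rewrite -!powRrM.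
  have -> : p * (r / p) = r by field; rewrite gt_eqF.
  have -> : p * (r / p - 1) = r - p by field; rewrite gt_eqF.
  rewrite -/V => h.
  have -> : `|v| `^ r / r - `|y| `^ r / r = (`|v| `^ r - `|y| `^ r) / r by rewrite mulrBl.
  rewrite ler_pdivrMr//.
  have -> : V * (`|v| `^ p / p - `|y| `^ p / p) * r =
            - (r / p * V * (`|y| `^ p - `|v| `^ p)).
    by field; rewrite gt_eqF.
  lra.
have S : `|v| `^ p / p - `|y| `^ p / p <= J * xi (v - y) + C * `|v - y| `^ p.
  have := smoothY y v _ (power_norm_subdifferential (ltW p1) xi1 xiy).
  by rewrite -[(_ *: xi) _]/(J * xi (v - y)); lra.
have Dp : `|v - y| `^ p <= e2 * `|v - y|.
  rewrite -mulr_powRB1// mulrC ler_wpM2r//.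
  have := ler_powR_base (ltW p10) (normr_ge0 _) vye.
  by rewrite -powRrM mulVf ?gt_eqF// powRr1// ltW.
have JJ : `|y| `^ (r - 1) = `|y| `^ (r - p) * J.
  rewrite /J; have [->|y0] := eqVneq y 0.
    by rewrite normr0 [X in _ = _ * X]powR0 ?gt_eqF// mulr0 powR0// gt_eqF//; lra.
  by rewrite -powRD ?normr_eq0 ?y0 ?implybT//; congr (_ `^ _); lra.
have xivy : `|xi (v - y)| <= `|v - y|.
  by rewrite ler_norml lerNl -linearN xi1 andbT (le_trans (xi1 _))// normrN.
rewrite JJ.
have A1 := ler_wpM2l V0 S.
have A2 : (V - `|y| `^ (r - p)) * (J * xi (v - y)) <= e / 2 * `|v - y|.
  rewrite (le_trans (ler_norm _))// normrM (le_trans (ler_pM _ _ Ve1 (lexx _)))//.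
  rewrite normrM (ger0_norm J0) mulrA; apply: ler_pM => //.
    by rewrite mulr_ge0// ltW.
  rewrite /e1 mulrAC ler_pdivrMr; last lra.
  by rewrite ler_wpM2l//; lra.
have A3 : V * (C * `|v - y| `^ p) <= e / 2 * `|v - y|.
  rewrite (@le_trans _ _ (M * (C * (e2 * `|v - y|))))//.
    by rewrite ler_pM// ?mulr_ge0 ?powR_ge0// ?ler_wpM2l// ltW.
  have -> : M * (C * (e2 * `|v - y|)) = C * M * e2 * `|v - y| by ring.
  rewrite ler_wpM2r// /e2 mulrCA ler_piMr//; first lra.
  by rewrite ler_pdivrMr// mul1r; lra.
move: A1 A2 A3 T; rewrite -/V.
set a := `|v| `^ r / r; set b := `|y| `^ r / r; set c := `|v| `^ p / p.
set d := `|y| `^ p / p; set f := `|y| `^ (r - p); rewrite mulrDr mulrBl mulrA.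
lra.
Qed.

End PowerOfNorm.

(** * The derivative of the discrepancy *)

Section Discrepancy.
Context {R : realType} {X Y : normedModType R}.
Variables (K : {linear X -> Y}) (f : Y) (p r : R).
Hypotheses (smoothY : smooth_power_type Y p) (p1 : 1 < p) (pr : p <= r).
Hypothesis cK : continuous K.
Let F := discrepancy K f r.

Lemma continuous_linear_bound :
  exists2 k : R, 0 < k & forall x, `|K x| <= k * `|x|.
Proof.
have /linear_boundedP/pinfty_ex_gt0[k k0 hk] : bounded_near K (nbhs 0).
  exact/linear_bounded_continuous.
by exists k.
Qed.

Lemma discrepancy_subgradient (u v : X) (xi : dual Y) :
  (forall y, xi y <= `|y|) -> xi (K u - f) = `|K u - f| ->
  F u + `|K u - f| `^ (r - 1) * xi (K (v - u)) <= F v.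
Proof.
move=> xi1 xiu; have r1 : 1 <= r := le_trans (ltW p1) pr.
have := power_norm_subgradient (K v - f) r1 xi1 xiu.
by rewrite opprB addrA subrK -linearB.
Qed.

Lemma discrepancy_expansion (u : X) (xi : dual Y) :
  (forall y, xi y <= `|y|) -> xi (K u - f) = `|K u - f| ->
  forall e : R, 0 < e -> exists2 d : R, 0 < d & forall v, `|v - u| <= d ->
    F v <= F u + `|K u - f| `^ (r - 1) * xi (K (v - u)) + e * `|v - u|.
Proof.
move=> xi1 xiu e e0; have [k k0 Kk] := continuous_linear_bound.
have [d d0 hd] := smooth_power_norm_expansion smoothY p1 pr xi1 xiu (divr_gt0 e0 k0).
exists (d / k); first by rewrite divr_gt0.
move=> v; rewrite ler_pdivlMr// mulrC => vud.
have E : K v - f - (K u - f) = K (v - u).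
  by rewrite opprB addrA subrK linearB.
have := hd (K v - f); rewrite E => /(_ (le_trans (Kk _) vud)).
rewrite -/(discrepancy K f r v) -/(discrepancy K f r u) -/F.
have : e / k * `|K (v - u)| <= e * `|v - u|.
  by rewrite -mulrA ler_wpM2l ?(ltW e0)// ler_pdivrMl.
lra.
Qed.

(** The remainder is nonnegative by the subgradient inequality and small by [discrepancy_expansion].
    The proof has to include differentiability, because elsewhere [frechet] may be the default
    [0]. *)
Lemma discrepancy_frechet (u : X) (xi : dual Y) :
  (forall y, xi y <= `|y|) -> xi (K u - f) = `|K u - f| ->
  forall h, frechet F u h = `|K u - f| `^ (r - 1) * xi (K h).
Proof.
move=> xi1 xiu; set c := `|K u - f| `^ (r - 1).
pose D h := c * xi (K h).
have lD : linear D by move=> a x y; rewrite /D !linearP /= mulrDr mulrCA.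
pose D' : {linear X -> R} := HB.pack D (GRing.isLinear.Build R X R _ D lD).
have cD : continuous D'.
  move=> x; apply: cvgM; first exact: cvg_cst.
  by apply: continuous_comp; [exact: cK|exact: dual_continuous].
have oF : F \o shift u = cst (F u) + D' +o_ 0 id.
  apply/eqaddoP => e e0; have [d d0 hd] := discrepancy_expansion xi1 xiu e0.
  apply/nbhs_ballP; exists d => //= h; rewrite -ball_normE /= sub0r normrN => hd'.
  have := hd (h + u); rewrite addrK => /(_ (ltW hd')) h1.
  have := discrepancy_subgradient (h + u) xi1 xiu; rewrite addrK => h2.
  rewrite -[X in `|X|]/(F (h + u) - (F u + c * xi (K h))).
  by rewrite ger0_norm ?subr_ge0// lerBlDl.
have dF : 'd F u = D' :> (X -> R) by exact: diff_unique.
have diffF : differentiable F u by apply/diff_locallyP; rewrite dF.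
by move=> h; rewrite frechetE// dF.
Qed.

End Discrepancy.

(** * Existence of minimizers *)

Section ConvexMinimization.
Context {R : realType} {X : normedModType R}.

Lemma reflexive_argmin_nonempty (G : X -> \bar R) (u0 : X) (M : R) :
  reflexive_space X -> (forall x, 0 <= G x)%E ->
  (forall (c : R) a b (t : R), (G a <= c%:E)%E -> (G b <= c%:E)%E ->
    0 <= t <= 1 -> (G (t *: a + (1 - t) *: b)%R <= c%:E)%E) ->
  lower_semicontinuous G -> (G u0 < +oo)%E ->
  (forall v, (G v <= G u0)%E -> `|v| <= M) ->
  argmin G !=set0.
Proof.
move=> reflX G0 convG lscG Gu0 bndG.
have fG v c : (G v <= c%:E)%E -> G v \is a fin_num.
  by move=> Gv; rewrite ge0_fin_numE// (le_lt_trans Gv)// ltry.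
have fGu0 : G u0 \is a fin_num by rewrite ge0_fin_numE.
pose S := [set fine (G v) | v in [set v | (G v < +oo)%E]].
pose m := inf S.
have lbS : has_lbound S by exists 0 => _ [v _ <-]; rewrite fine_ge0.
have mS v : (m%:E <= G v)%E.
  have [Gv|Gv] := ltP (G v) +oo%E; last by rewrite (le_trans _ Gv)// leey.
  rewrite -[leRHS]fineK ?ge0_fin_numE// lee_fin.
  by apply: ge_inf => //; exists v.
have [Gu0m|Gu0m] := leP (G u0) m%:E.
  by exists u0 => v; rewrite (le_trans Gu0m).
have m_lt : m < fine (G u0) by rewrite -lte_fin fineK.
(* The levels start at [G u0], so the first sublevel set is bounded, and stay above the infimum, so
   none is empty; a point common to all has value [m]. *)
pose c n := m + (fine (G u0) - m) / n.+1%:R.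
have c_gt n : m < c n by rewrite ltrDl divr_gt0// subr_gt0.
have c_le n : c n.+1 <= c n.
  by rewrite lerD2l ler_wpM2l ?subr_ge0 1?ltW// ltf_pV2 ?posrE// ltr_nat.
have [|||||x xA] := @reflexive_bigcap_nonempty _ _
    (fun n => [set v | (G v <= (c n)%:E)%E]) M reflX.
- move=> n; have S0 : S !=set0 by exists (fine (G u0)), u0.
  have cm : 0 < c n - m by rewrite subr_gt0.
  have [_ [v Gv <-]] := inf_adherent cm (conj S0 lbS).
  rewrite -/m addrC subrK => vc; exists v => /=.
  by rewrite -[leLHS]fineK ?ge0_fin_numE// lee_fin ltW.
- move=> n; rewrite -[X in closed X]setCK; apply: open_closedC.
  rewrite (_ : ~` _ = [set v | ((c n)%:E < G v)%E]).
    by move/lower_semicontinuousP : lscG; exact.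
  by apply/seteqP; split=> v /=; rewrite ltNge => /negP.
- by move=> n a b t /= Ga Gb t01; exact: convG.
- by move=> n v /=; move=> /le_trans; apply; rewrite lee_fin.
- move=> v /= Gv; apply: bndG; rewrite (le_trans Gv)//.
  by rewrite /c divr1 addrC subrK fineK.
exists x => v; rewrite (le_trans _ (mS v))//.
have fGx : G x \is a fin_num := fG _ _ (xA 0%N).
rewrite -(fineK fGx) lee_fin.
apply/ler_addgt0Pr => e e0.
pose n := Num.bound ((fine (G u0) - m) / e).
have : (fine (G u0) - m) / e < n%:R.
  by apply: archi_boundP; rewrite divr_ge0 ?subr_ge0 1?ltW.
rewrite ltr_pdivrMr// => nP.
have := xA n; rewrite /= -(fineK fGx) lee_fin => /le_trans; apply.
rewrite lerD2l ler_pdivrMr// mulrC (le_trans (ltW nP))//.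
by rewrite ler_wpM2r ?ltW// ltr_nat.
Qed.

End ConvexMinimization.

(** * Descent inequality for a Hoelder-continuous gradient *)

Section HolderDescent.
Context {R : realType} {X : normedModType R}.
Variables (F : X -> R) (DF : X -> dual X).
Hypothesis DF_sub : forall u v, F u + DF u (v - u) <= F v.

(* Discretises [\int_0^1 (DF (u + t (v - u)) - DF u) (v - u) dt], the
   differences of [F] being estimated by the subgradient inequality. *)
Lemma holder_descent (C L p : R) (u v : X) : 1 < p -> 0 < L ->
  holder_on [set v | `|v| <= C] L (p - 1) DF -> `|u| <= C -> `|v| <= C ->
  F v <= F u + DF u (v - u) + L / p * `|v - u| `^ p.
Proof.
move=> p1 L0 hol uC vC; have p0 : 0 < p by lra.
have p10 : 0 < p - 1 by lra.
set e := v - u; set E := `|e| `^ p; have E0 : 0 <= E := powR_ge0 _ _.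
have part (m : nat) : (0 < m)%N ->
    F v <= F u + DF u e + L / p * E + L * E / m%:R.
  move=> m0; have m0' : 0 < m%:R :> R by rewrite ltr0n.
  have [s sE] : exists s : nat -> R, forall k, s k = k%:R / m%:R.
    by exists (fun k => k%:R / m%:R).
  have s0 k : 0 <= s k by rewrite sE divr_ge0.
  have sS k : s k.+1 = s k + m%:R^-1.
    by rewrite !sE -[k.+1]addn1 natrD mulrDl mul1r.
  pose x k := u + s k *: e.
  (* The last term bounds the excess of the upper Riemann sum of [x^(p-1)] over its integral; it
     disappears as [m] grows. *)
  have claim k : (k <= m)%N -> F (x k) <= F u + s k * DF u e +
      L / p * E * s k `^ p + L * E / m%:R * s k `^ (p - 1).
    elim: k => [|k ih] km.
      rewrite /x sE mul0r scale0r addr0 !powR0 ?gt_eqF// !mulr0 mul0r.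
      by rewrite !addr0.
    have {ih} := ih (ltnW km).
    have s1 : s k.+1 <= 1 by rewrite sE ler_pdivrMr// mul1r ler_nat.
    have := DF_sub (x k.+1) (x k).
    have -> : x k - x k.+1 = - (m%:R^-1 *: e).
      by rewrite /x sS scalerDl addrA opprD addrA subrr add0r.
    have -> : DF (x k.+1) (- (m%:R^-1 *: e)) = - (m%:R^-1 * DF (x k.+1) e).
      by rewrite linearN; congr (- _); exact: linearZ.
    have xC : `|x k.+1| <= C.
      have -> : x k.+1 = (1 - s k.+1) *: u + s k.+1 *: v.
        by rewrite /x /e scalerBl scale1r scalerBr addrAC -addrA.
      apply: (le_trans (ler_normD _ _)); rewrite !normrZ.
      have -> : `|s k.+1| = s k.+1 by rewrite ger0_norm.
      have -> : `|1 - s k.+1| = 1 - s k.+1 by rewrite ger0_norm ?subr_ge0.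
      have : (1 - s k.+1) * `|u| <= (1 - s k.+1) * C.
        by rewrite ler_wpM2l// subr_ge0.
      have : s k.+1 * `|v| <= s k.+1 * C by rewrite ler_wpM2l.
      lra.
    have hD : DF (x k.+1) e <= DF u e + L * E * s k.+1 `^ (p - 1).
      have := dual_ler_norm (DF (x k.+1) - DF u) e.
      rewrite -[leLHS]/(DF (x k.+1) e - DF u e) lerBlDl => /le_trans; apply.
      rewrite lerD2l (le_trans (ler_wpM2r (normr_ge0 _) (hol _ _ xC uC)))//.
      have -> : x k.+1 - u = s k.+1 *: e by rewrite /x addrAC subrr add0r.
      rewrite normrZ ger0_norm// powRM// /E -(mulr_powRB1 (normr_ge0 e) p0).
      by rewrite le_eqVlt; apply/orP; left; apply/eqP; ring.
    have mi : 0 < m%:R^-1 :> R by rewrite invr_gt0.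
    have := ler_wpM2l (ltW mi) hD.
    have := powR_tangent (s0 k.+1) (s0 k) (ltW p1).
    have -> : s k.+1 - s k = m%:R^-1 by rewrite sS addrAC subrr add0r.
    have LE : 0 <= L / p * E by rewrite mulr_ge0// divr_ge0// ltW.
    move=> /(ler_wpM2l LE).
    have -> : L / p * E * (s k `^ p + p * s k `^ (p - 1) * m%:R^-1) =
              L / p * E * s k `^ p + L * E / m%:R * s k `^ (p - 1).
      by field; rewrite !gt_eqF.
    rewrite sS [(s k + _) * _]mulrDl mulrDr.
    set a := DF (_ + _) e.
    lra.
  have := claim m (leqnn _).
  rewrite /x sE divff ?gt_eqF// scale1r !powR1 !mulr1 mul1r.
  by rewrite /e addrC subrK.
apply/ler_addgt0Pr => d d0.
pose n := Num.bound (L * E / d).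
have LE0 : 0 <= L * E by rewrite mulr_ge0// ltW.
have : L * E / d < n%:R by apply: archi_boundP; rewrite divr_ge0// ltW.
rewrite ltr_pdivrMr// => nP.
rewrite (le_trans (part n.+1 _))// lerD2l ler_pdivrMr// (le_trans (ltW nP))//.
by rewrite mulrC ler_wpM2l ?ltW// ltr_nat.
Qed.

End HolderDescent.

(** * From a recursive decrease to a power rate *)

Section DescentRate.
Context {R : realType}.

(** The reciprocal of [x n] grows by at least [1] in each step; the product form also covers a
    vanishing [x n]. *)
Lemma logistic_decay (x : nat -> R) :
  (forall n, 0 <= x n <= 1) -> (forall n, x n.+1 <= x n * (1 - x n)) ->
  forall n, n%:R * x n <= 1.
Proof.
move=> x01 xS; elim=> [|n ih]; first by rewrite mul0r.
have /andP[x0 x1] := x01 n.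
have n0 : 0 <= n%:R :> R by [].
apply: (le_trans (ler_wpM2l _ (xS n))) => //.
rewrite -[n.+1]addn1 natrD mulrDl mul1r mulrA.
have : n%:R * x n * (1 - x n) <= 1 * (1 - x n).
  by rewrite ler_wpM2r// subr_ge0.
have : 0 <= x n * x n by rewrite mulr_ge0.
lra.
Qed.

(* Optimising [D n >= t * r n - t `^ p * Q] over [t] gives
   [D n >= c * r n `^ (1 + b)] with [b = (p - 1)^-1]. *)
Lemma descent_rate (r D : nat -> R) (p delta Q : R) :
  1 < p <= 2 -> 0 < delta < 1 -> 0 < Q ->
  (forall n, 0 <= r n) -> (forall n, 0 <= D n) ->
  (forall n, r n.+1 <= r n - delta * D n) ->
  (forall n (t : R), 0 <= t <= 1 -> t * r n - t `^ p * Q <= D n) ->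
  exists2 C : R, 0 < C & forall n, (0 < n)%N -> r n <= C * n%:R `^ (1 - p).
Proof.
move=> /andP[p1 p2] /andP[d0 d1] Q0 r0 D0 rS rD.
have p10 : 0 < p - 1 by lra.
have p0 : 0 < p by lra.
have r_le n : r n <= r 0%N.
  elim: n => // n; apply: le_trans; rewrite (le_trans (rS n))// gerBl.
  by rewrite mulr_ge0// ltW.
(* The expression [t * r n - t^p * Q] is maximal at [t = (r n / (p * Q))^b]. Enlarging [p * Q] to
   [q] keeps this choice in [[0, 1]] and changes only constants. *)
pose q := p * Q + r 0%N.
have q0 : 0 < q by rewrite ltr_wpDr// mulr_gt0.
pose b := (p - 1)^-1.
have b1 : 1 <= b by rewrite invf_ge1//; lra.
have b0 : 0 < b by lra.
have rq n : 0 <= r n / q <= 1.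
  rewrite divr_ge0 ?(ltW q0)//= ler_pdivrMr// mul1r (le_trans (r_le n))//.
  by rewrite lerDr mulr_ge0// ltW.
pose t n := (r n / q) `^ b.
have t0 n : 0 <= t n := powR_ge0 _ _.
have t1 n : t n <= 1.
  have /andP[? ?] := rq n.
  have := ler_powR_base (ltW b0) (_ : 0 <= r n / q) (_ : r n / q <= 1).
  by rewrite powR1; exact.
have tp n : t n `^ p = t n * (r n / q).
  rewrite -mulr_powRB1//; congr (_ * _).
  by rewrite -powRrM mulVf ?gt_eqF// powRr1//; have /andP[] := rq n.
pose k := delta * (1 - p^-1).
have ip : 0 < p^-1 < 1 by rewrite invr_gt0 p0 invf_lt1.
have k0 : 0 < k by rewrite mulr_gt0//; lra.
have k1 : k <= 1 by rewrite mulr_ile1//; lra.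
have step n : r n.+1 <= r n * (1 - k * t n).
  have := rD n (t n); rewrite t0 t1 => /(_ isT); rewrite tp.
  have /andP[rq0 _] := rq n.
  have : Q * (r n / q) <= p^-1 * r n.
    rewrite mulrA ler_pdivrMr// mulrAC ler_wpM2r// ler_pdivlMl//.
    by rewrite lerDl.
  move=> /(ler_wpM2l (t0 n)) h1 h2.
  have /(ler_wpM2l (ltW d0)) : t n * r n * (1 - p^-1) <= D n by lra.
  have := rS n; rewrite /k; set pp := p^-1; lra.
have kt n : 0 <= k * t n <= 1.
  by rewrite mulr_ge0 ?(ltW k0)//= mulr_ile1// ltW.
(* This is where [p <= 2] matters: [b >= 1] gives [(1 - k * t n)^b <= 1 - k * t n]. *)
have xS n : k * t n.+1 <= k * t n * (1 - k * t n).
  rewrite -mulrA ler_wpM2l ?(ltW k0)//.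
  have /andP[kt0 kt1] := kt n.
  have : t n.+1 <= (r n / q * (1 - k * t n)) `^ b.
    apply: ler_powR_base; first exact: ltW.
      by have /andP[] := rq n.+1.
    by rewrite mulrAC ler_wpM2r// ?invr_ge0 ?(ltW q0)// step.
  move=> /le_trans; apply.
  have /andP[rq0 _] := rq n.
  have : 0 <= 1 - k * t n <= 1 by rewrite subr_ge0 kt1 gerBl.
  move: (1 - k * t n) => y /andP[y0 y1].
  rewrite powRM// -/(t n) ler_wpM2l//.
  have [->|z] := eqVneq y 0; first by rewrite powR0// gt_eqF.
  by apply: ge1r_powR => //; rewrite lt0r z y0.
have x_le := logistic_decay kt xS.
exists (q * k `^ (1 - p)); first by rewrite mulr_gt0// powR_gt0.
move=> n n0; have n0' : 0 < n%:R :> R by rewrite ltr0n.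
rewrite -mulrA -(powRM _ (ltW k0) (ltW n0')) -ler_pdivrMl// mulrC.
have kn : 0 < k * n%:R by rewrite mulr_gt0.
have /(ler_powR_base (ltW p10) (t0 n)) : t n <= (k * n%:R)^-1.
  by rewrite -[leRHS]mul1r ler_pdivlMr// mulrC mulrAC mulrC.
rewrite -powRrM mulVf ?gt_eqF// powRr1; last by have /andP[] := rq n.
by rewrite -(powR_inv1 (ltW kn)) -powRrM mulN1r opprB.
Qed.

End DescentRate.

(** * One forward-backward step and the rate of the objective *)

Section ForwardBackward.
Context {R : realType} {X : normedModType R}.
Variables (F : X -> R) (Phi : X -> \bar R) (p : R).
Let DF := frechet F.
Hypothesis p12 : 1 < p <= 2.
Hypothesis F_sub : forall u v, F u + DF u (v - u) <= F v.
Hypothesis F_exp : forall u (e : R), 0 < e -> exists2 d : R, 0 < d &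
  forall v, `|v - u| <= d -> F v <= F u + DF u (v - u) + e * `|v - u|.
Hypothesis Phi_ge0 : forall v, (0 <= Phi v)%E.
Hypothesis Phi_conv : forall u v (t : R), (Phi u < +oo)%E -> (Phi v < +oo)%E ->
  0 <= t <= 1 ->
  (Phi (t *: u + (1 - t) *: v)%R <=
    (t * fine (Phi u) + (1 - t) * fine (Phi v))%:E)%E.

Let phi v := fine (Phi v).

Let PhiE v : (Phi v < +oo)%E -> Phi v = (phi v)%:E.
Proof. by move=> Pv; rewrite fineK// ge0_fin_numE. Qed.

Let p0 : 0 < p. Proof. by case/andP: p12; lra. Qed.

Lemma continuous_of_expansion : continuous F.
Proof.
move=> u; apply/cvgrPdist_le => e e0.
have [d d0 hd] := F_exp u ltr01.
pose k := `|DF u| + 1.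
have k0 : 0 < k by rewrite ltr_wpDl.
apply/nbhs_ballP; exists (Num.min d (e / k)).
  by rewrite /= lt_min d0 divr_gt0.
move=> v; rewrite -ball_normE /= lt_min => /andP[vd vk].
rewrite distrC in vd vk; rewrite distrC.
have h1 := hd _ (ltW vd).
have h2 := F_sub u v.
have h3 := dual_ler_norm (DF u) (v - u).
have h4 := dual_ler_norm (DF u) (- (v - u)).
rewrite linearN normrN in h4.
have h5 : k * `|v - u| <= e by rewrite mulrC -ler_pdivlMr// ltW.
rewrite /k mulrDl mul1r in h5.
have h6 : 0 <= `|v - u| := normr_ge0 _.
by rewrite ler_norml; apply/andP; split; lra.
Qed.

Section Step.
Variables (C L delta tau : R) (u v : X).
Hypotheses (L0 : 0 < L) (d01 : 0 < delta < 1) (tau0 : 0 < tau).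
Hypothesis tauL : tau <= p * (1 - delta) / L.
Hypothesis Phiu : (Phi u < +oo)%E.
Hypothesis ballC : forall x,
  (objective F Phi x <= objective F Phi u)%E -> `|x| <= C.
Hypothesis holC : holder_on [set x | `|x| <= C] L (p - 1) DF.
Hypothesis vmin : argmin (step_objective p tau (DF u) Phi u) v.

Let e := v - u.
Let D := phi u - phi v - DF u e.

Lemma step_finite : (Phi v < +oo)%E.
Proof.
have : (step_objective p tau (DF u) Phi u v < +oo)%E.
  by rewrite (le_lt_trans (vmin u))// /step_objective (PhiE Phiu) ltry.
apply: contraPT; rewrite -leNgt leye_eq => /eqP Pv; apply/negP.
by rewrite -leNgt /step_objective Pv addey// gt0_muley ?lte_fin// addey.
Qed.

Lemma step_le x : (Phi x < +oo)%E ->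
  `|v - u| `^ p / p + tau * (DF u v + phi v) <=
  `|x - u| `^ p / p + tau * (DF u x + phi x).
Proof.
have E y : (Phi y < +oo)%E -> step_objective p tau (DF u) Phi u y =
    (`|y - u| `^ p / p + tau * (DF u y + phi y))%:E.
  by move=> Py; rewrite /step_objective (PhiE Py).
by move=> Phix; have := vmin x; rewrite !E ?lee_fin//; exact: step_finite.
Qed.

Lemma step_segment x t : (Phi x < +oo)%E -> 0 <= t <= 1 ->
  `|e| `^ p / p + tau * t * (phi u - phi x - DF u (x - u)) <=
  t `^ p * (`|x - u| `^ p / p) + tau * D.
Proof.
move=> Phix t01; have /andP[t0 t1] := t01.
set y := t *: x + (1 - t) *: u.
have yu : y - u = t *: (x - u).
  by rewrite /y scalerBl scale1r scalerBr addrA addrAC addrK.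
have Py := Phi_conv Phix Phiu t01; rewrite -/y in Py.
have Phiy : (Phi y < +oo)%E by rewrite (le_lt_trans Py)// ltry.
have := step_le Phiy.
rewrite (PhiE Phiy) lee_fin -/(phi x) -/(phi u) in Py.
rewrite yu normrZ ger0_norm// powRM//.
have -> : DF u y = DF u u + t * DF u (x - u).
  rewrite -[y](subrK u) addrC yu linearD; congr (_ + _); exact: linearZ.
have -> : DF u v = DF u u + DF u e by rewrite -linearD /e addrC subrK.
have := ler_wpM2l (ltW tau0) Py.
by rewrite -/e /D; lra.
Qed.

(** Comparison with [u] alone would only bound [|e|^p / p]. Comparing with points of the segment
    from [u] to [v] and letting them approach [v] gives the factor [1], which matches the step size
    bound [p * (1 - delta) / L]. *)
Lemma step_norm_le : `|e| `^ p <= tau * D.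
Proof.
have /andP[p1 p2] := p12; set E := `|e| `^ p; have E0 : 0 <= E := powR_ge0 _ _.
have h t : 0 < t <= 1 -> E * (1 - t) <= tau * D.
  move=> /andP[t0 t1]; have t01 : 0 <= 1 - t <= 1 by lra.
  have := step_segment step_finite t01; rewrite -/e -/E -/D.
  have [t1'|t1'] := eqVneq t 1.
    rewrite t1' subrr !powR0 ?gt_eqF// !mulr0 !mul0r addr0 add0r.
    by apply: le_trans; rewrite divr_ge0 ?(ltW p0).
  have T := powR_tangent ler01 (_ : 0 <= 1 - t) (ltW p1).
  have {}T := T ltac:(lra); rewrite powR1 in T.
  have t0' : 0 < 1 - t <= 1 by rewrite subr_gt0 lt_neqAle t1' t1/=; lra.
  have Q : 1 - t <= (1 - t) `^ (p - 1) by apply: ger1_powR => //; lra.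
  have Et : 0 <= E * t / p by rewrite divr_ge0 ?mulr_ge0// ltW.
  have := ler_wpM2l (_ : 0 <= E / p) T; rewrite divr_ge0 ?(ltW p0)// => /(_ isT).
  have -> : E / p * ((1 - t) `^ p + p * (1 - t) `^ (p - 1) * (1 - (1 - t))) =
    E / p * (1 - t) `^ p + t * (E * (1 - t) `^ (p - 1)).
    by field; rewrite gt_eqF.
  move=> T1 T2.
  have T3 : t * (E * (1 - t) `^ (p - 1)) <= t * (tau * D) by lra.
  rewrite ler_pM2l// in T3; apply: le_trans T3.
  exact: ler_wpM2l.
apply/ler_addgt0Pr => d d0.
have E10 : 0 < E + 1 by rewrite ltr_wpDl.
have t0 : 0 < Num.min 1 (d / (E + 1)) by rewrite lt_min ltr01 divr_gt0.
have := h (Num.min 1 (d / (E + 1))); rewrite t0 ge_min lexx => /(_ isT).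
have : E * Num.min 1 (d / (E + 1)) <= d.
  rewrite (@le_trans _ _ (E * (d / (E + 1))))//.
    by rewrite ler_wpM2l// ge_min lexx orbT.
  rewrite mulrCA ger_pMr// ler_pdivrMr// mul1r lerDl; exact: ler01.
lra.
Qed.

Lemma step_gap_ge0 : 0 <= D.
Proof. by rewrite -(pmulr_rge0 _ tau0) (le_trans _ step_norm_le)// powR_ge0. Qed.

Lemma step_gap_lower x t : (Phi x < +oo)%E -> 0 <= t <= 1 ->
  t * (F u + phi u - (F x + phi x)) - t `^ p * (`|x - u| `^ p / (p * tau)) <= D.
Proof.
move=> Phix t01; have := step_segment Phix t01; have /andP[t0 t1] := t01.
have E0 : 0 <= `|e| `^ p / p by rewrite divr_ge0 ?powR_ge0// ltW.
have := ler_wpM2l t0 (F_sub u x) => h1 h2.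
rewrite -(ler_pM2l tau0) mulrBr.
have -> : tau * (t `^ p * (`|x - u| `^ p / (p * tau))) = t `^ p * (`|x - u| `^ p / p).
  by field; rewrite !gt_eqF.
have := ler_wpM2l (ltW tau0) h1; lra.
Qed.

(* If the objective increased, it would take its initial value again at a point
   [u + T e] with [0 < T < 1]; this point lies in the ball of radius [C], where
   the Hoelder estimate shows a strict decrease. *)
Lemma step_decrease : F v + phi v <= F u + phi u - delta * D.
Proof.
have /andP[p1 p2] := p12; have /andP[d0 d1] := d01.
have [D0|D0] := eqVneq D 0.
  have := step_norm_le; rewrite D0 mulr0 => e0.
  have : `|e| `^ p == 0 by rewrite eq_le e0 powR_ge0.
  rewrite powR_eq0 normr_eq0 => /andP[/eqP ee _].
  have -> : v = u by apply/eqP; rewrite -subr_eq0 -/e ee.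
  by rewrite mulr0 subr0.
have {}D0 : 0 < D by rewrite lt0r D0 step_gap_ge0.
(* By convexity of [Phi], [g] majorises the objective on the segment; it is continuous even where
   [Phi] is only lower semicontinuous, so the intermediate value theorem applies. *)
pose g t := F (u + t *: e) + (1 - t) * phi u + t * phi v.
have g0 : g 0 = F u + phi u by rewrite /g scale0r addr0; lra.
have g1 : g 1 = F v + phi v.
  have E : u + e = v by rewrite /e addrC subrK.
  by rewrite /g scale1r E subrr mul0r addr0 mul1r.
have claim T : 0 <= T <= 1 -> g T <= g 0 -> g T <= g 0 - delta * T * D.
  move=> T01; have /andP[T0 T1] := T01 => gT.
  have xE : u + T *: e = T *: v + (1 - T) *: u.
    by rewrite /e scalerBr scalerBl scale1r addrCA addrA addrAC.
  have Px := Phi_conv step_finite Phiu T01; rewrite -xE in Px.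
  have xC : `|u + T *: e| <= C.
    apply: ballC; rewrite /objective (PhiE Phiu) -EFinD.
    apply: (le_trans (leeD2l _ Px)); rewrite -EFinD lee_fin.
    by move: gT; rewrite g0 /g -/(phi v) -/(phi u); lra.
  have uC : `|u| <= C by apply: ballC.
  have := holder_descent F_sub p1 L0 holC uC xC.
  have -> : u + T *: e - u = T *: e by rewrite addrAC subrr add0r.
  have -> : DF u (T *: e) = T * DF u e by exact: linearZ.
  rewrite normrZ (ger0_norm T0) powRM//.
  have TT : T `^ p <= T.
    have [->|Tn0] := eqVneq T 0; first by rewrite powR0// gt_eqF.
    by apply: ge1r_powR; [rewrite lt0r Tn0 T0|exact: ltW].
  have LE : L / p * `|e| `^ p <= (1 - delta) * D.
    rewrite mulrAC ler_pdivrMr//.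
    apply: (le_trans (ler_wpM2l (ltW L0) step_norm_le)).
    have := tauL; rewrite ler_pdivlMr// => /(ler_wpM2r (ltW D0)).
    by rewrite mulrAC -mulrA; lra.
  have : L / p * (T `^ p * `|e| `^ p) <= T * ((1 - delta) * D).
    rewrite mulrCA ler_pM ?powR_ge0// mulr_ge0 ?powR_ge0// divr_ge0// ltW//.
  rewrite g0 /g /D; lra.
have [gle|ggt] := leP (g 1) (g 0).
  by have := claim 1; rewrite lexx ler01 mulr1 g0 g1 => /(_ isT); apply; rewrite -g0 -g1.
exfalso.
(* The slope of [g] at [0] is [- D], so [g] dips below [g 0] before exceeding it at [1]. *)
have [t0 [t00 t01 gt0]] : exists t0, [/\ 0 < t0, t0 <= 1 & g t0 < g 0].
  have ne : 0 < `|e| + 1 by rewrite ltr_wpDl.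
  have [d d00 hd] := F_exp u (divr_gt0 D0 ne).
  pose t := Num.min 1 (d / (`|e| + 1)).
  have t00 : 0 < t by rewrite lt_min ltr01 divr_gt0.
  have t01 : t <= 1 by rewrite ge_min lexx.
  exists t; split => //.
  have := hd (u + t *: e).
  have -> : u + t *: e - u = t *: e by rewrite addrAC subrr add0r.
  have -> : DF u (t *: e) = t * DF u e by exact: linearZ.
  rewrite normrZ gtr0_norm// => hd'.
  have {}hd' := hd' ltac:(rewrite (@le_trans _ _ (t * (`|e| + 1)))//;
    [rewrite ler_pM2l// lerDl; exact: ler01
    |rewrite -ler_pdivlMr// ge_min lexx orbT//]).
  have : D / (`|e| + 1) * (t * `|e|) < t * D.
    rewrite mulrCA ltr_pM2l// mulrAC ltr_pdivrMr// ltr_pM2l//.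
    by rewrite ltrDl.
  move: hd'; rewrite g0 /g /D; lra.
have cg : {within `[t0, 1], continuous g}.
  apply: continuous_subspaceT => t; apply: cvgD; last first.
    by apply: cvgM; [exact: cvg_id|exact: cvg_cst].
  apply: cvgD; last first.
    apply: cvgM; last exact: cvg_cst.
    by apply: cvgB; [exact: cvg_cst|exact: cvg_id].
  apply: (@cvg_comp _ _ _ (fun t : R => u + t *: e) F); last first.
    exact: continuous_of_expansion.
  apply: cvgD; first exact: cvg_cst.
  by apply: cvgZr_tmp; exact: cvg_id.
have g01 : Num.min (g t0) (g 1) <= g 0 <= Num.max (g t0) (g 1).
  by rewrite ge_min (ltW gt0) le_max (ltW ggt) orbT.
have [T] := IVT t01 cg g01; rewrite in_itv/= => /andP[Tt0 T1] gT.
have T0 : 0 < T := lt_le_trans t00 Tt0.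
have := claim T; rewrite (ltW T0) T1 gT lexx => /(_ isT isT).
have : 0 < delta * T * D by rewrite !mulr_gt0.
lra.
Qed.

End Step.

Lemma forward_backward_finite (delta tau0 : R) (C L tau : nat -> R)
    (u : nat -> X) : 0 < tau0 ->
  forward_backward p delta tau0 F Phi C L tau u -> forall n, (Phi (u n) < +oo)%E.
Proof.
move=> t0 [init _ _ _ tauP step _]; elim=> // n ih.
have /andP[taun _] := tauP n.
exact: (step_finite (lt_le_trans t0 taun) ih (step n)).
Qed.

Lemma forward_backward_rate (delta tau0 : R) (C L tau : nat -> R)
    (u : nat -> X) (x : X) : 0 < delta < 1 -> 0 < tau0 ->
  forward_backward p delta tau0 F Phi C L tau u ->
  argmin (objective F Phi) x -> (Phi x < +oo)%E ->
  exists2 c : R, 0 < c & forall n, (0 < n)%N ->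
    F (u n) + phi (u n) - (F x + phi x) <= c * n%:R `^ (1 - p).
Proof.
move=> d01 t0 fb xmin Phix; have Phiu := forward_backward_finite t0 fb.
have /andP[p1 p2] := p12; have /andP[d0 d1] := d01.
case: fb => init ballC L0 holC tauP step _.
pose r n := F (u n) + phi (u n) - (F x + phi x).
pose D n := phi (u n) - phi (u n.+1) - DF (u n) (u n.+1 - u n).
have tau0n n : 0 < tau n by have /andP[h _] := tauP n; exact: lt_le_trans h.
have tauL n : tau n <= p * (1 - delta) / L n by have /andP[] := tauP n.
have D0 n : 0 <= D n := step_gap_ge0 (tau0n n) (Phiu n) (step n).
have rS n : r n.+1 <= r n - delta * D n.
  have := step_decrease (L0 n) d01 (tau0n n) (tauL n) (Phiu n) (@ballC n)
    (holC n) (step n).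
  by rewrite /r /D; lra.
have objE n : objective F Phi (u n) = (F (u n) + phi (u n))%:E.
  by rewrite /objective (PhiE (Phiu n)).
have r0 n : 0 <= r n.
  have := xmin (u n); rewrite objE /objective (PhiE Phix) -EFinD lee_fin.
  by rewrite subr_ge0.
have obj_le n : F (u n) + phi (u n) <= F (u 0%N) + phi (u 0%N).
  elim: n => // n; apply: le_trans; have := rS n; rewrite /r.
  by have := mulr_ge0 (ltW d0) (D0 n); lra.
have uC n : `|u n| <= C 0%N by apply: ballC; rewrite !objE lee_fin.
pose M := `|x| + C 0%N + 1.
have M0 : 0 < M by rewrite ltr_wpDl// addr_ge0// (le_trans _ (uC 0%N)).
have xuM n : `|x - u n| <= M.
  by rewrite (le_trans (ler_normB _ _))// /M; have := uC n; lra.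
(* The constant is uniform in [n]: the iterates stay in the first ball and the step sizes above
   [tau0]. *)
apply: (@descent_rate _ r D p delta (M `^ p / (p * tau0))) => //.
  by rewrite divr_gt0 ?powR_gt0// mulr_gt0.
move=> n t t01; have := step_gap_lower (tau0n n) (Phiu n) (step n) Phix t01.
apply: le_trans; rewrite lerD2l lerN2 ler_wpM2l ?powR_ge0//.
rewrite ler_pM ?powR_ge0 ?invr_ge0 ?mulr_ge0 ?(ltW p0) ?(ltW (tau0n n))//.
  by rewrite ler_powR_base// ltW.
rewrite lef_pV2 ?posrE ?mulr_gt0// ler_pM2l//.
by have /andP[] := tauP n.
Qed.

End ForwardBackward.

(** * Local growth of powers of a uniformly convex norm *)

Section LocalGrowth.
Context {R : realType}.

Lemma powR_le1_antitone (x s t : R) : 0 <= x <= 1 -> 0 < s -> s <= t ->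
  x `^ t <= x `^ s.
Proof.
move=> /andP[x0 x1] s0 st; have [->|xn0] := eqVneq x 0.
  by rewrite !powR0 ?gt_eqF// (lt_le_trans s0).
by apply: ger_powR => //; rewrite lt0r xn0 x0.
Qed.

Lemma powRD_le (x y t : R) : 0 <= x -> 0 <= y -> 0 <= t ->
  (x + y) `^ t <= 2 `^ t * (x `^ t + y `^ t).
Proof.
move=> x0 y0 t0; wlog xy : x y x0 y0 / x <= y => [hw|].
  have [xy|/ltW yx] := leP x y; first exact: hw.
  by rewrite addrC [x `^ t + _]addrC hw.
rewrite (@le_trans _ _ ((2 * y) `^ t))//.
  by apply: ler_powR_base => //; [rewrite addr_ge0|lra].
by rewrite powRM// ler_wpM2l ?powR_ge0// lerDr powR_ge0.
Qed.

(* The right-hand side separates the radial part, governed by the scalar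
   function [x `^ t], from the part [B * x - B - l] of a norm. *)
Lemma powR_bregman_split (B x l t : R) : 0 < B -> 0 <= x -> 0 < t ->
  (B * x) `^ t / t - B `^ t / t - B `^ (t - 1) * l =
  B `^ t * ((x `^ t - 1) / t - (x - 1)) + B `^ (t - 1) * (B * x - B - l).
Proof.
move=> B0 x0 t0; rewrite powRM ?(ltW B0)//.
rewrite -(mulr_powRB1 (ltW B0) t0); set b := B `^ (t - 1).
by field; rewrite gt_eqF.
Qed.

Section Norm.
Context {Y : normedModType R}.

(** At the midpoint of [v] and [y] the functional [xi] bounds the norm from below by
    [(1 + xi v) / 2], while the modulus of convexity bounds it from above. *)
Lemma convex_power_type_support (q : R) : convex_power_type Y q -> 0 < q ->
  exists2 c : R, 0 < c & forall (y v : Y) (xi : dual Y),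
    (forall v, xi v <= `|v|) -> `|y| = 1 -> xi y = 1 -> `|v| = 1 ->
    c * `|v - y| `^ q <= 1 - xi v.
Proof.
move=> [c c0 convY] q0; exists c => // y v xi xi1 y1 xiy v1.
have [->|vy] := eqVneq v y.
  by rewrite subrr normr0 powR0 ?gt_eqF// mulr0 xiy subrr.
have vy2 : 0 < `|v - y| <= 2.
  rewrite normr_gt0 subr_eq0 vy/=.
  by rewrite (le_trans (ler_normB _ _))// v1 y1.
have h : (modulus_of_convexity (V := Y) `|v - y|%R <=
    (1 - `|2^-1 *: (v + y)|)%R%:E)%E.
  by apply: ereal_inf_lbound; exists (v, y).
have := le_trans (convY _ vy2) h; rewrite lee_fin => {}h.
have := xi1 (2^-1 *: (v + y)).
have -> : xi (2^-1 *: (v + y)) = 2^-1 * (xi v + 1).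
  by rewrite -xiy -linearD; exact: linearZ.
have : 0 <= c * `|v - y| `^ q by rewrite mulr_ge0 ?powR_ge0// ltW.
lra.
Qed.

(** Going from [y] to [v] changes the radius, at a quadratic cost by [powR_bregman1], and the
    direction, at a cost given by [convex_power_type_support] for the normalised vectors. At [y = 0]
    there is no direction and [r <= q] suffices. *)
Lemma power_norm_growth (r q : R) (y : Y) (xi : dual Y) :
  convex_power_type Y q -> 1 < r -> r <= q -> 2 <= q ->
  (forall v, xi v <= `|v|) -> xi y = `|y| ->
  exists c d : R, [/\ 0 < c, 0 < d & forall v, `|v - y| <= d ->
    c * `|v - y| `^ q <=
      `|v| `^ r / r - `|y| `^ r / r - `|y| `^ (r - 1) * xi (v - y)].
Proof.
move=> convY r1 rq q2 xi1 xiy.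
have r0 : 0 < r by lra.
have q0 : 0 < q by lra.
have [->|yn0] := eqVneq y 0.
  exists r^-1, 1; split; rewrite ?invr_gt0// => v.
  rewrite subr0 normr0 !powR0 ?gt_eqF//; last lra.
  rewrite !mul0r !subr0 => v1.
  by rewrite mulrC ler_wpM2r ?invr_ge0 ?(ltW r0)// powR_le1_antitone// normr_ge0.
have [c2 c20 supp] := convex_power_type_support convY q0.
have [c1 [C1 [c10 _ breg]]] := powR_bregman1 r1.
set B := `|y| in xiy *.
have B0 : 0 < B by rewrite normr_gt0.
have Bn0 : B != 0 by rewrite gt_eqF.
have tq0 : 0 < 2 `^ q :> R by rewrite powR_gt0.
(* The constant [c2] is halved because [A >= B / 2]; the power of [2] cancels the factor of [eps^q]
   in [distq]. *)
pose m := Num.min c1 (c2 / 2 / 2 `^ q).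
have m0 : 0 < m by rewrite lt_min c10 !divr_gt0.
exists (m * B `^ r / (B `^ q * 2 `^ q)), (B / 2); split.
- by rewrite divr_gt0 ?mulr_gt0 ?powR_gt0.
- by rewrite divr_gt0.
move=> v vy; set A := `|v|.
have AB : `|A - B| <= B / 2 by rewrite (le_trans (ler_dist_dist _ _)).
have [AB1 AB2] : B / 2 <= A /\ A <= 2 * B.
  by move: AB; rewrite ler_norml => /andP[]; split; lra.
have A0 : 0 < A by rewrite (lt_le_trans _ AB1)// divr_gt0.
have An0 : A != 0 by rewrite gt_eqF.
pose x := A / B.
have Bx : B * x = A by rewrite /x mulrC divfK.
have x2 : 2^-1 <= x <= 2.
  by rewrite ler_pdivlMr// ler_pdivrMr// AB2 mulrC AB1.
have x0 : 0 <= x by lra.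
have xi_vy : xi (v - y) = xi v - B by rewrite -xiy; exact: linearB.
rewrite xi_vy -{1}Bx powR_bregman_split// Bx.
have /andP[br _] := breg _ x2.
set v1 := A^-1 *: v; set y1 := B^-1 *: y; set eps := `|v1 - y1|.
have := supp y1 v1 xi xi1.
rewrite !normrZ !normfV !normr_id mulVf// mulVf//.
have -> : xi y1 = 1.
  have -> : xi y1 = B^-1 * xi y by exact: linearZ.
  by rewrite xiy mulVf.
move=> /(_ erefl erefl erefl); rewrite -/eps => sup.
have xiv : xi v = A * xi v1.
  have -> : xi v1 = A^-1 * xi v by exact: linearZ.
  by rewrite mulVKf.
have E0 : 0 <= eps := normr_ge0 _.
have Eq0 : 0 <= eps `^ q := powR_ge0 _ _.
have part2 : B * (c2 / 2 * eps `^ q) <= A - B - (xi v - B).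
  have h : A * (c2 * eps `^ q) <= A * (1 - xi v1) by rewrite ler_wpM2l// ltW.
  have : B / 2 * (c2 * eps `^ q) <= A * (c2 * eps `^ q).
    by rewrite ler_wpM2r// mulr_ge0// ltW.
  rewrite xiv; lra.
have x1le : `|x - 1| <= 1 by rewrite ler_norml; apply/andP; split; lra.
have part1 : c1 * `|x - 1| `^ q <= (x `^ r - 1) / r - (x - 1).
  apply: le_trans br; rewrite ler_wpM2l ?(ltW c10)//.
  rewrite -real_normK ?num_real// -powR_mulrn//.
  by rewrite powR_le1_antitone// normr_ge0.
have dist : `|v - y| <= B * (2 * eps + `|x - 1|).
  have -> : v - y = A *: (v1 - y1) + (A - B) *: y1.
    rewrite /v1 /y1 scalerBr scalerBl !scalerA mulfV// mulfV// !scale1r.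
    by rewrite addrA subrK.
  have ny1 : `|y1| = 1 by rewrite normrZ normfV normr_id mulVf.
  rewrite (le_trans (ler_normD _ _))// 2!normrZ ny1 mulr1.
  have -> : A - B = B * (x - 1) by rewrite mulrBr Bx mulr1.
  rewrite normrM (gtr0_norm A0) (gtr0_norm B0) mulrDr lerD2r mulrA.
  by rewrite ler_wpM2r// mulrC.
have distq : `|v - y| `^ q <=
    B `^ q * 2 `^ q * (2 `^ q * eps `^ q + `|x - 1| `^ q).
  apply: (le_trans (ler_powR_base (ltW q0) (normr_ge0 _) dist)).
  rewrite powRM ?(ltW B0) ?addr_ge0 ?mulr_ge0// -mulrA.
  rewrite ler_wpM2l ?powR_ge0// -powRM//.
  by apply: powRD_le; rewrite ?mulr_ge0// ltW.
have Bq : 0 < B `^ q * 2 `^ q by rewrite mulr_gt0// powR_gt0.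
rewrite mulrAC ler_pdivrMr//.
have mBr : 0 <= m * B `^ r by rewrite mulr_ge0 ?powR_ge0// ltW.
apply: (le_trans (ler_wpM2l mBr distq)).
rewrite -(mulr_powRB1 (ltW B0) r0).
have b0 : 0 <= B `^ (r - 1) := powR_ge0 _ _.
set b := B `^ (r - 1) in b0 *.
have m1 : m <= c1 by rewrite ge_min lexx.
have m2 : m * 2 `^ q <= c2 / 2 by rewrite -ler_pdivlMr// ge_min lexx orbT.
have X0 : 0 <= `|x - 1| `^ q := powR_ge0 _ _.
have h1 := ler_wpM2r X0 m1.
have h2 := ler_wpM2r Eq0 m2.
have h3 : B * b * (m * `|x - 1| `^ q) <= B * b * ((x `^ r - 1) / r - (x - 1)).
  by rewrite ler_wpM2l ?mulr_ge0 ?(ltW B0)// (le_trans h1).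
have h4 : b * (B * (m * 2 `^ q * eps `^ q)) <= b * (A - B - (xi v - B)).
  by rewrite ler_wpM2l// (le_trans _ part2)// ler_wpM2l// ltW.
rewrite [leRHS]mulrC.
have -> : m * (B * b) * (B `^ q * 2 `^ q * (2 `^ q * eps `^ q + `|x - 1| `^ q)) =
  B `^ q * 2 `^ q * (B * b * (m * `|x - 1| `^ q) +
    b * (B * (m * 2 `^ q * eps `^ q))) by ring.
by rewrite ler_wpM2l ?(ltW Bq)// lerD.
Qed.

End Norm.
End LocalGrowth.

(** * Local growth of powers of the seminorm *)

Section SeminormGrowth.
Context {R : realType} {Z : normedModType R}.
Variable N : Z -> R.
Hypothesis semiN : is_seminorm N.

Let N_ge0 z : 0 <= N z. Proof. by have [h _ _] := semiN. Qed.
Let NZ (a : R) z : N (a *: z) = `|a| * N z. Proof. by have [_ h _] := semiN. Qed.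
Let N_triangle x y : N (x + y) <= N x + N y. Proof. by have [_ _ h] := semiN. Qed.

Lemma seminorm0 : N 0 = 0.
Proof. by have := NZ 0 0; rewrite scale0r normr0 mul0r. Qed.

Lemma seminormN z : N (- z) = N z.
Proof. by rewrite -scaleN1r NZ normrN normr1 mul1r. Qed.

Lemma seminorm_dist x y : `|N x - N y| <= N (x - y).
Proof.
have h1 := N_triangle (x - y) y; rewrite subrK in h1.
have h2 := N_triangle (y - x) x; rewrite subrK -opprB seminormN in h2.
by rewrite ler_norml; apply/andP; split; lra.
Qed.

Lemma seminormD_kernel x a : N a = 0 -> N (x + a) = N x.
Proof.
move=> Na; have h1 := N_triangle x a.
have h2 := N_triangle (x + a) (- a); rewrite addrK seminormN in h2.
by apply/eqP; rewrite eq_le; apply/andP; split; lra.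
Qed.

Lemma seminorm_power_convex (s t : R) x y : 1 <= s -> 0 <= t <= 1 ->
  N (t *: x + (1 - t) *: y) `^ s / s <=
    t * (N x `^ s / s) + (1 - t) * (N y `^ s / s).
Proof.
move=> s1 /andP[t0 t1]; have s0 : 0 < s by lra.
have ct : 0 <= 1 - t by lra.
set c := t * N x + (1 - t) * N y.
have c0 : 0 <= c by rewrite addr_ge0// mulr_ge0.
have Nc : N (t *: x + (1 - t) *: y) <= c.
  by rewrite (le_trans (N_triangle _ _))// !NZ !ger0_norm.
have h1 := ler_wpM2l t0 (powR_tangent (N_ge0 x) c0 s1).
have h2 := ler_wpM2l ct (powR_tangent (N_ge0 y) c0 s1).
rewrite !mulrA -mulrDl ler_wpM2r ?invr_ge0 ?(ltW s0)//.
apply: (le_trans (ler_powR_base (ltW s0) (N_ge0 _) Nc)).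
set k := s * c `^ (s - 1) in h1 h2.
have -> : c `^ s = t * (c `^ s + k * (N x - c)) + (1 - t) * (c `^ s + k * (N y - c)).
  by rewrite /c; ring.
exact: lerD.
Qed.

Section Subgradient.
Variables (alpha s : R) (z0 : Z) (zeta : dual Z).
Hypotheses (a0 : 0 < alpha) (s1 : 1 <= s).
Hypothesis zetaP : subdifferential (fun z => alpha * (N z `^ s / s)) z0 zeta.

Let s0 : 0 < s. Proof. exact: lt_le_trans s1. Qed.

(** A chain rule in the form of an inequality: on the segment from [z0] to [z] the seminorm lies
    below its linear interpolation, and the parameter is sent to [0]. Thus [zeta], divided by
    [alpha * N z0^(s-1)], is a subgradient of [N] itself. *)
Lemma power_seminorm_subgradient_le z : 0 < N z0 ->
  zeta (z - z0) <= alpha * N z0 `^ (s - 1) * (N z - N z0).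
Proof.
move=> B0; set A := N z; set B := N z0.
have h t : 0 < t <= 1 ->
    zeta (z - z0) <= alpha * (B + t * (A - B)) `^ (s - 1) * (A - B).
  move=> /andP[t0 t1]; set B' := B + t * (A - B).
  have B'E : B' = t * A + (1 - t) * B by rewrite /B'; ring.
  have B'0 : 0 <= B' by rewrite B'E addr_ge0// mulr_ge0 ?subr_ge0 ?N_ge0 ?(ltW t0).
  have := zetaP (z0 + t *: (z - z0)).
  have -> : z0 + t *: (z - z0) - z0 = t *: (z - z0) by rewrite addrAC subrr add0r.
  have -> : zeta (t *: (z - z0)) = t * zeta (z - z0) by exact: linearZ.
  have Nle : N (z0 + t *: (z - z0)) <= B'.
    have -> : z0 + t *: (z - z0) = t *: z + (1 - t) *: z0.
      by rewrite scalerBr scalerBl scale1r addrCA addrA addrAC.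
    rewrite (le_trans (N_triangle _ _))// !NZ !ger0_norm ?subr_ge0 ?(ltW t0)//.
    by rewrite B'E.
  have := ler_powR_base (ltW s0) (N_ge0 _) Nle.
  have := powR_tangent (ltW B0) B'0 s1; rewrite -/B.
  set P := N (_ + _) `^ s => T1 T2 T3.
  rewrite -(ler_pM2l t0).
  have T4 : alpha * (P / s) <=
      alpha * (B `^ s / s) + alpha * B' `^ (s - 1) * (t * (A - B)).
    rewrite -(ler_pM2r s0).
    have -> : alpha * (P / s) * s = alpha * P by field; rewrite gt_eqF.
    have -> : (alpha * (B `^ s / s) + alpha * B' `^ (s - 1) * (t * (A - B))) * s =
      alpha * (B `^ s - s * B' `^ (s - 1) * (B - B')).
      by rewrite {3}/B'; field; rewrite gt_eqF.
    by rewrite ler_pM2l//; lra.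
  by rewrite mulrCA; lra.
apply/ler_addgt0Pr => e e0.
pose k := alpha * (`|A - B| + 1).
have k0 : 0 < k by rewrite mulr_gt0// ltr_wpDl.
have s10 : 0 <= s - 1 by rewrite subr_ge0.
have [d d0 hd] := powR_continuous_at s10 (ltW B0) (divr_gt0 e0 k0).
pose t := Num.min 1 (d / (`|A - B| + 1)).
have n0 : 0 < `|A - B| + 1 by rewrite ltr_wpDl.
have t0 : 0 < t by rewrite lt_min ltr01 divr_gt0.
have t1 : t <= 1 by rewrite ge_min lexx.
have := h t; rewrite t0 t1 => /(_ isT) /le_trans; apply.
have B'0 : 0 <= B + t * (A - B).
  have -> : B + t * (A - B) = t * A + (1 - t) * B by ring.
  by rewrite addr_ge0// mulr_ge0 ?subr_ge0 ?N_ge0 ?(ltW t0).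
have := hd _ B'0; rewrite addrAC subrr add0r normrM gtr0_norm// => hd'.
have {}hd' := hd' _; have td : t * `|A - B| <= d.
  rewrite (@le_trans _ _ (d / (`|A - B| + 1) * `|A - B|))//.
    by rewrite ler_wpM2r// ge_min lexx orbT.
  by rewrite mulrAC ler_pdivrMr// ler_wpM2l ?(ltW d0)// lerDl; exact: ler01.
have {}hd' := hd' td; set U := (B + _) `^ _ in hd' *; set W := B `^ _ in hd' *.
have : alpha * ((U - W) * (A - B)) <= e.
  rewrite (@le_trans _ _ (alpha * (e / k * `|A - B|)))//.
    rewrite ler_pM2l// (le_trans (ler_norm _))// normrM ler_wpM2r//.
  have -> : alpha * (e / k * `|A - B|) = e * ((alpha * `|A - B|) / k) by ring.
  rewrite ger_pMr// ler_pdivrMr// mul1r ler_pM2l// lerDl; exact: ler01.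
lra.
Qed.

(** For [s = 1] the penalty is linear along the ray through [z0], so the Bregman distance from [z0]
    to [2 *: z0] vanishes, although their difference is [z0]. *)
Lemma linear_seminorm_subgradient_kernel : s = 1 ->
  totally_convex (fun z => alpha * (N z `^ s / s)) N -> N z0 = 0.
Proof.
move=> s1' tc; apply/eqP/negP => /negP Nz0.
have e1 : 2 *: z0 - z0 = z0 by rewrite scaler_nat mulr2n addrK.
have := tc z0 (fun=> 2 *: z0) zeta zetaP; have := zetaP 0; have := zetaP (2 *: z0).
rewrite /= e1 s1' !divr1 !powRr1// NZ ger0_norm// seminorm0 sub0r linearN.
move=> h1 h2; have -> : zeta z0 = alpha * N z0 by lra.
have -> : alpha * (2 * N z0) - alpha * N z0 - alpha * N z0 = 0 by ring.
move=> /(_ (cvg_cst _))/(cvg_lim (@Rhausdorff R)).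
by rewrite lim_cst// => /eqP; rewrite (negbTE Nz0).
Qed.

(** If no [k] worked, rescaling would give directions with [N h = 1] and Bregman distances tending
    to [0], against total convexity. *)
Lemma linear_seminorm_subgradient_gap : s = 1 -> N z0 = 0 ->
  totally_convex (fun z => alpha * (N z `^ s / s)) N ->
  exists2 k : R, 0 < k & forall h, k * N h <= alpha * N h - zeta h.
Proof.
move=> s1' Nz0 tc; apply: contrapT => nk.
have sub h : zeta h <= alpha * N h.
  have := zetaP (h + z0); rewrite addrK s1' !divr1 !powRr1// Nz0.
  by rewrite seminormD_kernel// mulr0 add0r.
have bad n : exists h, N h = 1 /\ alpha - zeta h <= n.+1%:R^-1.
  have n0 : 0 < n.+1%:R^-1 :> R by rewrite invr_gt0.
  have [h hP] : exists h, alpha * N h - zeta h < n.+1%:R^-1 * N h.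
    apply: contrapT => nh; apply: nk; exists n.+1%:R^-1 => // h.
    by rewrite leNgt; apply/negP => hlt; apply: nh; exists h.
  have Nh : 0 < N h.
    by rewrite -(pmulr_rgt0 _ n0) (le_lt_trans _ hP)// subr_ge0.
  exists ((N h)^-1 *: h); rewrite NZ normfV ger0_norm// mulVf ?gt_eqF//.
  split => //; have -> : zeta ((N h)^-1 *: h) = (N h)^-1 * zeta h by exact: linearZ.
  rewrite -(ler_pM2r Nh) mulrBl mulrAC mulVf ?gt_eqF// mul1r.
  exact: ltW.
have [g gP] := choice bad.
have := tc z0 (fun n => g n + z0) zeta zetaP.
have -> : (fun n => N (g n + z0 - z0)) = fun=> 1.
  by apply/funext => n; rewrite addrK; case: (gP n).
have -> : (fun n => alpha * (N (g n + z0) `^ s / s) - alpha * (N z0 `^ s / s) -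
    zeta (g n + z0 - z0)) = fun n => alpha - zeta (g n).
  apply/funext => n; rewrite addrK s1' !divr1 !powRr1// Nz0.
  by rewrite seminormD_kernel// (gP n).1; ring.
have lim0 : alpha - zeta (g n) @[n --> \oo] --> (0 : R).
  apply: (@squeeze_cvgr _ _ _ _ (fun=> 0) harmonic); last 2 first.
  - exact: cvg_cst.
  - exact: cvg_harmonic.
  near=> n; have [g1 g2] := gP n; rewrite g2 andbT.
  by have := sub (g n); rewrite g1; lra.
move=> /(_ lim0)/(cvg_lim (@Rhausdorff R)); rewrite lim_cst// => /eqP.
by rewrite oner_eq0.
Unshelve. all: by end_near. Qed.

Lemma power_seminorm_subgradient_kernel h : 1 < s -> N z0 = 0 -> zeta h <= 0.
Proof.
move=> s1' Nz0; rewrite leNgt; apply/negP => zh.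
have s10 : 0 < s - 1 by lra.
pose c := alpha * (N h `^ s / s).
have c0 : 0 <= c by rewrite mulr_ge0 ?divr_ge0 ?powR_ge0// ltW.
have c10 : 0 < c + 1 by rewrite ltr_wpDl.
(* Chosen so that [t^(s-1) * c] falls short of [zeta h]: the penalty of [t *: h] is then smaller
   than [t * zeta h]. *)
pose t := (zeta h / (c + 1)) `^ (s - 1)^-1.
have q0 : 0 < zeta h / (c + 1) by rewrite divr_gt0.
have t0 : 0 < t by rewrite powR_gt0.
have := zetaP (t *: h + z0); rewrite addrK seminormD_kernel// Nz0 NZ gtr0_norm//.
rewrite powR0 ?gt_eqF// mul0r mulr0 add0r powRM ?(ltW t0) ?N_ge0//.
have -> : zeta (t *: h) = t * zeta h by exact: linearZ.
rewrite -(mulr_powRB1 (ltW t0) s0) -powRrM mulVf ?gt_eqF// powRr1 ?(ltW q0)//.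
have -> : alpha * (t * (zeta h / (c + 1)) * N h `^ s / s) =
    t * (zeta h / (c + 1) * (alpha * (N h `^ s / s))) by ring.
rewrite -/c mulrAC -[_ * c / _]mulrA.
rewrite ler_pM2l// ler_pMr// ler_pdivlMr// mul1r.
by rewrite gerDl leNgt ltr01.
Qed.

End Subgradient.

(* The cases are: [s = 1], where total convexity forces [N z0 = 0] and, by
   homogeneity, a linear lower bound; [s > 1] and [N z0 = 0], where the
   subgradient vanishes; [s > 1] and [N z0 > 0], where subgradients of
   [N ^ s] and [N ^ q] at [z0] are proportional. In the last case
   [convex_power_type_at] only applies to norm-bounded sets, so [z - z0] is
   replaced by its component in the complement of the kernel of [N]. *)
Lemma power_seminorm_growth (alpha s q c1 : R) (z0 : Z) (zeta : dual Z) :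
  0 < alpha -> 1 <= s -> s <= q -> 2 <= q -> 0 < c1 ->
  (forall z, exists a b, [/\ N a = 0, z = a + b & c1 * `|b| <= N b]) ->
  subdifferential (fun z => alpha * (N z `^ s / s)) z0 zeta ->
  totally_convex (fun z => alpha * (N z `^ s / s)) N ->
  convex_power_type_at q N z0 ->
  exists c d : R, [/\ 0 < c, 0 < d & forall z, N (z - z0) <= d ->
    c * N (z - z0) `^ q <=
      alpha * (N z `^ s / s) - alpha * (N z0 `^ s / s) - zeta (z - z0)].
Proof.
move=> a0 s1 sq q2 c10 split_ker zetaP tc convN.
have s0 : 0 < s by lra.
have q0 : 0 < q by lra.
have q1 : 1 < q by lra.
have Nsub z : N z0 = 0 -> N z = N (z - z0).
  by move=> Nz0; rewrite -(seminormD_kernel (z - z0) Nz0) subrK.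
have [Es|sn1] := eqVneq s 1.
  have Nz0 := linear_seminorm_subgradient_kernel zetaP Es tc.
  have [k k0 hk] := linear_seminorm_subgradient_gap zetaP Es Nz0 tc.
  exists k, 1; split => // z; rewrite Es !divr1 !powRr1// Nz0 mulr0 subr0 (Nsub z Nz0).
  move=> Nz1; apply: le_trans (hk _); rewrite ler_pM2l//.
  rewrite -[leRHS](powRr1 (N_ge0 _)) powR_le1_antitone ?N_ge0//.
  by lra.
have {sn1} s1' : 1 < s by rewrite lt_neqAle eq_sym sn1.
have [Nz0|Nz0] := eqVneq (N z0) 0.
  exists (alpha / s), 1; split; rewrite ?divr_gt0// => z; rewrite (Nsub z Nz0) => Nz1.
  rewrite Nz0 powR0 ?gt_eqF// mul0r mulr0 subr0.
  have := power_seminorm_subgradient_kernel a0 s1 zetaP (z - z0) s1' Nz0.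
  have : alpha / s * N (z - z0) `^ q <= alpha / s * N (z - z0) `^ s.
    rewrite ler_wpM2l ?divr_ge0 ?(ltW a0) ?(ltW s0)//.
    by rewrite powR_le1_antitone ?N_ge0.
  have -> : alpha * (N (z - z0) `^ s / s) = alpha / s * N (z - z0) `^ s by ring.
  lra.
set B := N z0; have B0 : 0 < B by rewrite lt0r Nz0 N_ge0.
have Bn0 : B != 0 := Nz0.
have zeta_le z := power_seminorm_subgradient_le a0 s1 zetaP z B0.
pose k := alpha * B `^ (s - 1); have k0 : 0 < k by rewrite mulr_gt0// powR_gt0.
have zetaN z : k^-1 * zeta (z - z0) <= N z - B by rewrite ler_pdivrMl// zeta_le.
pose m := B `^ (q - 1) / k.
have m0 : 0 < m by rewrite divr_gt0// powR_gt0.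
have zetaq : subdifferential (fun z => N z `^ q / q) z0 (m *: zeta).
  move=> z; rewrite -[(m *: zeta) _]/(m * zeta (z - z0)).
  have := powR_tangent (N_ge0 z) (ltW B0) (ltW q1); rewrite -/B => T.
  rewrite -(ler_pM2r q0) mulrDl !divfK ?gt_eqF//.
  apply: le_trans T; rewrite lerD2l.
  have -> : m * zeta (z - z0) * q = q * B `^ (q - 1) * (k^-1 * zeta (z - z0)).
    by rewrite /m; ring.
  by rewrite ler_wpM2l ?mulr_ge0 ?powR_ge0 ?(ltW q0).
have M0 : 0 < B / 2 / c1 by rewrite !divr_gt0.
have [c c0 hc] := convN _ _ M0 zetaq.
have [cs [Cs [cs0 _ bs]]] := powR_bregman1 s1'.
have [cq [Cq [_ Cq0 bq]]] := powR_bregman1 q1.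
(* The quotient compares the scalar Bregman distances for [q] and [s]; [r >= 1] lets the same factor
   serve for the linear part [A - B - l]. *)
pose r := Num.max 1 (Cq / cs).
have r0 : 0 < r by rewrite lt_max ltr01.
pose D := r * B `^ q / (alpha * B `^ s).
have D0 : 0 < D by apply: divr_gt0; apply: mulr_gt0 => //; exact: powR_gt0.
exists (c / D), (B / 2); split; [exact: divr_gt0|exact: divr_gt0|move=> z NzB].
have [a [b [Na zab bN]]] := split_ker (z - z0).
have zE : z = z0 + b + a by rewrite -addrA [b + a]addrC -zab addrC subrK.
have Nz : N z = N (z0 + b) by rewrite zE seminormD_kernel.
have Nb : N (z - z0) = N b by rewrite zab addrC seminormD_kernel.
(* Moving along the kernel leaves [N] unchanged, so [zeta_le] applied to [a] and [- a] makes [zeta]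
   vanish there. *)
have zeta_a : zeta a = 0.
  have h (x : Z) : N x = 0 -> zeta x <= 0.
    move=> Nx; have := zeta_le (x + z0); rewrite addrK [x + z0]addrC seminormD_kernel//.
    by rewrite subrr mulr0.
  apply/eqP; rewrite eq_le h//=.
  by have := h (- a); rewrite seminormN linearN oppr_le0; apply.
have zeta_b : zeta (z - z0) = zeta b by rewrite zab -[RHS]add0r -zeta_a; exact: linearD.
have bM : `|z0 + b - z0| <= B / 2 / c1.
  by rewrite addrAC subrr add0r ler_pdivlMr// mulrC (le_trans bN)// -Nb.
have := hc _ bM; have -> : z0 + b - z0 = b by rewrite addrAC subrr add0r.
rewrite -Nz -[(m *: zeta) b]/(m * zeta b) -/B => {}hc.
rewrite zeta_b Nb -/B.
set A := N z in hc *.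
have AB : `|A - B| <= B / 2 by rewrite (le_trans (seminorm_dist _ _)).
have [AB1 AB2] : B / 2 <= A /\ A <= 2 * B.
  by move: AB; rewrite ler_norml => /andP[]; split; lra.
pose x := A / B.
have Bx : B * x = A by rewrite /x mulrC divfK.
have x2 : 2^-1 <= x <= 2 by rewrite ler_pdivlMr// ler_pdivrMr// AB2 mulrC AB1.
have x0 : 0 <= x by lra.
pose l := k^-1 * zeta b.
have lE : zeta b = k * l by rewrite /l mulVKf// gt_eqF.
have G0 : 0 <= A - B - l by rewrite subr_ge0 /l -zeta_b zetaN.
have := powR_bregman_split l B0 x0 s0.
have := powR_bregman_split l B0 x0 q0.
rewrite Bx; have /andP[bs1 _] := bs _ x2; have /andP[_ bq2] := bq _ x2.
have mk : m * zeta b = B `^ (q - 1) * l.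
  by rewrite lE /m mulrA divfK// gt_eqF.
rewrite mk in hc.
set Es := (x `^ s - 1) / s - (x - 1) in bs1 *.
set Eq := (x `^ q - 1) / q - (x - 1) in bq2 *.
move=> splitq splits; rewrite splitq in hc.
have -> : alpha * (A `^ s / s) - alpha * (B `^ s / s) - zeta b =
    alpha * (A `^ s / s - B `^ s / s - B `^ (s - 1) * l).
  by rewrite lE /k; ring.
rewrite splits mulrAC ler_pdivrMr//; apply: (le_trans hc).
have x10 : 0 <= (x - 1) ^+ 2 := sqr_ge0 _.
have Es0 : 0 <= Es by rewrite (le_trans _ bs1)// mulr_ge0// ltW.
have EqEs : Eq <= r * Es.
  apply: (le_trans bq2); rewrite (@le_trans _ _ (Cq / cs * Es))//.
    by rewrite -mulrA ler_wpM2l ?(ltW Cq0)// ler_pdivlMl.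
  by rewrite ler_wpM2r// le_max lexx orbT.
have r1 : 1 <= r by rewrite le_max lexx.
have bq0 : 0 <= B `^ (q - 1) := powR_ge0 _ _.
have bs0 : 0 < B `^ (s - 1) by rewrite powR_gt0.
have -> : alpha * (B `^ s * Es + B `^ (s - 1) * (A - B - l)) * D =
    B `^ q * (r * Es) + B `^ (q - 1) * (r * (A - B - l)).
  rewrite /D -(mulr_powRB1 (ltW B0) s0) -(mulr_powRB1 (ltW B0) q0).
  by field; rewrite Bn0 !gt_eqF.
apply: lerD; first by rewrite ler_wpM2l ?powR_ge0.
by rewrite ler_wpM2l// ler_peMl.
Qed.

End SeminormGrowth.

(** * Lower semicontinuity of a sum and decay of negative powers *)

Lemma lower_semicontinuousD_continuous {R : realType} {T : topologicalType}
    (g : T -> R) (h : T -> \bar R) : continuous g -> lower_semicontinuous h ->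
  lower_semicontinuous (fun x => (g x)%:E + h x)%E.
Proof.
move=> cg lsch x a ax.
have [b ab bh] : exists2 b : R, a - g x < b & (b%:E < h x)%E.
  move: ax; case: (h x) => [c| |//] ax.
    exists ((a - g x + c) / 2); rewrite ?lte_fin; move: ax; rewrite -EFinD lte_fin; lra.
  by exists (a - g x + 1); rewrite ?ltry//; lra.
have [V xV hV] := lsch _ _ bh.
have e0 : 0 < b - (a - g x) by rewrite subr_gt0.
have [W xW gW] : exists2 W, nbhs x W & forall y, W y -> g x - (b - (a - g x)) < g y.
  exists [set y | `|g x - g y| < b - (a - g x)].
    by move/cvgrPdist_lt : (cg x) => /(_ _ e0).
  by move=> y /=; rewrite ltr_norml => /andP[_]; lra.
exists (V `&` W); first exact: filterI.
move=> y [/hV by_ /gW gy].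
rewrite (@lt_le_trans _ _ (g y + b)%:E)//; first by rewrite lte_fin; lra.
by rewrite EFinD leeD2l// ltW.
Qed.

Lemma cvg_natr_powR0 {R : realType} (a : R) : a < 0 ->
  n%:R `^ a @[n --> \oo] --> (0 : R).
Proof.
move=> a0; rewrite -cvg_shiftS /=; apply/cvgrPdist_le => e e0.
have na0 : 0 <= - a by rewrite oppr_ge0 ltW.
have [d d0 hd] := powR_continuous_at na0 (lexx 0) e0.
have /cvgrPdist_le/(_ _ d0) := @cvg_harmonic R.
apply: filterS => n; rewrite distrC subr0 /= => nd.
have := hd n.+1%:R^-1; rewrite invr_ge0 subr0 => /(_ (ler0n _ _) nd).
rewrite [0 `^ _]powR0 ?oppr_eq0 ?lt_eqF// subr0 distrC subr0.
by rewrite -powR_inv1// -powRrM mulN1r opprK.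
Qed.

(** * First-order optimality condition *)

Section FirstOrder.
Context {R : realType} {X Z : normedModType R}.

(** Minimality is tested at small parameters [t] on the segment towards [z] and divided by [t]: the
    linear part [l] survives, the remainder of [F] does not. *)
Lemma minimizer_subgradient (iota : {linear Z -> X}) (F : X -> R) (l : dual X)
    (g : Z -> R) (z0 : Z) :
  (forall e : R, 0 < e -> exists2 d : R, 0 < d & forall v, `|v - iota z0| <= d ->
    F v <= F (iota z0) + l (v - iota z0) + e * `|v - iota z0|) ->
  (forall x y (t : R), 0 <= t <= 1 ->
    g (t *: x + (1 - t) *: y) <= t * g x + (1 - t) * g y) ->
  (forall z, F (iota z0) + g z0 <= F (iota z) + g z) ->
  forall z, g z0 - l (iota (z - z0)) <= g z.
Proof.
move=> expF convg zmin z; apply/ler_addgt0Pr => e e0.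
set d := iota (z - z0).
have n0 : 0 < `|d| + 1 by rewrite ltr_wpDl.
have [h h0 hF] := expF _ (divr_gt0 e0 n0).
pose t := Num.min 1 (h / (`|d| + 1)).
have t0 : 0 < t by rewrite lt_min ltr01 divr_gt0.
have t1 : t <= 1 by rewrite ge_min lexx.
have t01 : 0 <= t <= 1 by rewrite ltW.
have := convg z z0 t t01.
have := zmin (t *: z + (1 - t) *: z0).
have yE : iota (t *: z + (1 - t) *: z0) - iota z0 = t *: d.
  rewrite /d -linearB -linearZ; congr (iota _).
  by rewrite scalerBl scale1r scalerBr addrA addrAC addrK.
have := hF (iota (t *: z + (1 - t) *: z0)); rewrite yE normrZ gtr0_norm//.
have -> : l (t *: d) = t * l d by exact: linearZ.
have td : t * `|d| <= h.
  rewrite (@le_trans _ _ (t * (`|d| + 1)))//.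
    by rewrite ler_pM2l// lerDl; exact: ler01.
  by rewrite -ler_pdivlMr// ge_min lexx orbT.
move=> /(_ td).
have : e / (`|d| + 1) * (t * `|d|) <= t * e.
  rewrite mulrCA ler_pM2l// mulrAC ler_pdivrMr// ler_pM2l// lerDl; exact: ler01.
set u := F (iota (_ + _)); set w := g (_ + _).
move=> h1 h2 h3 h4; rewrite -(ler_pM2l t0); lra.
Qed.

End FirstOrder.

(** * The regularised problem: convexity, uniqueness, convergence and rate *)

Section Tikhonov.
Context {R : realType} {X Y Z : normedModType R}.
Variables (K : {linear X -> Y}) (f : Y) (r s alpha : R).
Variables (iota : {linear Z -> X}) (N : Z -> R) (p c1 c3 : R).
Let F := discrepancy K f r.
Let Phi := penalty iota N s alpha.
Let phi z := alpha * (N z `^ s / s).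
Let J z := F (iota z) + phi z.
Hypotheses (cK : continuous K) (s1 : 1 <= s) (a0 : 0 < alpha).
Hypotheses (iotaI : injective iota) (ciota : continuous iota).
Hypothesis semiN : is_seminorm N.
Hypotheses (c10 : 0 < c1) (c30 : 0 < c3).
Hypothesis split_ker :
  forall z, exists a b, [/\ N a = 0, z = a + b & c1 * `|b| <= N b].
Hypothesis K_ker : forall a, N a = 0 -> c3 * `|iota a| <= `|K (iota a)|.
Hypotheses (p1 : 1 < p) (pr : p <= r) (smoothY : smooth_power_type Y p).

Let s0 : 0 < s. Proof. exact: lt_le_trans s1. Qed.
Let r1 : 1 < r. Proof. exact: lt_le_trans pr. Qed.
Let r0 : 0 < r. Proof. exact: lt_trans r1. Qed.

Lemma penalty_range z : Phi (iota z) = (phi z)%:E.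
Proof. exact: penalty_iota. Qed.

Lemma penalty_ge0 u : (0 <= Phi u)%E.
Proof.
have [[z _ <-]|nu] := pselect (range iota u); last by rewrite /Phi penalty_pinfty.
by rewrite penalty_range lee_fin mulr_ge0 ?divr_ge0 ?powR_ge0// ltW.
Qed.

Lemma penalty_finite u : (Phi u < +oo)%E -> exists z, u = iota z.
Proof.
move=> Pu; have [[z _ <-]|nu] := pselect (range iota u); first by exists z.
by move: Pu; rewrite /Phi penalty_pinfty.
Qed.

Lemma seminorm_penalty_convex x y (t : R) : 0 <= t <= 1 ->
  phi (t *: x + (1 - t) *: y) <= t * phi x + (1 - t) * phi y.
Proof.
move=> t01; have := seminorm_power_convex semiN x y s1 t01.
by move=> /(ler_wpM2l (ltW a0)); rewrite /phi mulrDr !(mulrCA alpha).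
Qed.

Lemma penalty_convex u v (t : R) : (Phi u < +oo)%E -> (Phi v < +oo)%E ->
  0 <= t <= 1 ->
  (Phi (t *: u + (1 - t) *: v)%R <=
    (t * fine (Phi u) + (1 - t) * fine (Phi v))%:E)%E.
Proof.
move=> /penalty_finite[x ->] /penalty_finite[y ->] t01.
have -> : t *: iota x + (1 - t) *: iota y = iota (t *: x + (1 - t) *: y).
  by rewrite linearD !linearZ.
by rewrite !penalty_range lee_fin seminorm_penalty_convex.
Qed.

Lemma discrepancy_frechet_subgradient u v : F u + frechet F u (v - u) <= F v.
Proof.
have [xi xi1 xiu] := norming_functional (K u - f).
rewrite (discrepancy_frechet smoothY p1 pr cK xi1 xiu).
exact: (discrepancy_subgradient p1 pr).
Qed.

Lemma discrepancy_frechet_expansion u (e : R) : 0 < e -> exists2 d : R, 0 < d &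
  forall v, `|v - u| <= d -> F v <= F u + frechet F u (v - u) + e * `|v - u|.
Proof.
move=> e0; have [xi xi1 xiu] := norming_functional (K u - f).
have [d d0 hd] := discrepancy_expansion smoothY p1 pr cK xi1 xiu e0.
exists d => // v vd; rewrite (discrepancy_frechet smoothY p1 pr cK xi1 xiu).
exact: hd.
Qed.

Lemma objective_range z : objective F Phi (iota z) = (J z)%:E.
Proof. by rewrite /objective penalty_range. Qed.

Lemma objective_ge0 u : (0 <= objective F Phi u)%E.
Proof.
by rewrite adde_ge0 ?penalty_ge0// lee_fin divr_ge0 ?powR_ge0// ltW.
Qed.

Lemma objective_finite u (c : R) : (objective F Phi u <= c%:E)%E ->
  exists z, u = iota z.
Proof.
move=> uc; apply: penalty_finite; have := le_lt_trans uc (ltry c).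
by apply: contraTT; rewrite -!leNgt !leye_eq /objective => /eqP ->.
Qed.

Lemma objective_sublevel_convex (c : R) a b (t : R) :
  (objective F Phi a <= c%:E)%E -> (objective F Phi b <= c%:E)%E ->
  0 <= t <= 1 -> (objective F Phi (t *: a + (1 - t) *: b)%R <= c%:E)%E.
Proof.
move=> ac bc t01; have /andP[t0 t1] := t01.
have [x ax] := objective_finite ac; have [y by_] := objective_finite bc.
subst a b; move: ac bc.
set m := t *: iota x + (1 - t) *: iota y.
have mE : m = iota (t *: x + (1 - t) *: y) by rewrite linearD !linearZ.
(* Convexity of [F] comes from its subgradient at the intermediate point [m], where the weighted
   linear terms cancel. *)
have h1 := ler_wpM2l t0 (discrepancy_frechet_subgradient m (iota x)).
have t1' : 0 <= 1 - t by rewrite subr_ge0.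
have h2 := ler_wpM2l t1' (discrepancy_frechet_subgradient m (iota y)).
have h3 : t * frechet F m (iota x - m) + (1 - t) * frechet F m (iota y - m) = 0.
  have E (l : R) d : l * frechet F m d = frechet F m (l *: d).
    by apply/esym; exact: linearZ.
  rewrite !E -linearD !scalerBr addrACA -opprD -scalerDl.
  have -> : t + (1 - t) = 1 by ring.
  by rewrite scale1r subrr linear0.
have := seminorm_penalty_convex x y t01.
rewrite mE !objective_range !lee_fin /J -mE => h4 /(ler_wpM2l t0) h5 /(ler_wpM2l t1') h6.
lra.
Qed.

(** The component [b] is controlled by [N]. The kernel component is recovered from
    [K (iota a) = K (iota z) - K (iota b)], because [K] is bounded below on the kernel. *)
Lemma embedding_bound :
  exists2 k : R, 0 < k & forall z, `|iota z| <= k * (N z + `|K (iota z)|).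
Proof.
have [ki ki0 hi] := continuous_linear_bound ciota.
have [kK kK0 hKb] := continuous_linear_bound cK.
pose k1 := ki / c1; have k10 : 0 < k1 by rewrite divr_gt0.
exists (k1 + c3^-1 * (1 + kK * k1)).
  by rewrite addr_gt0// mulr_gt0 ?invr_gt0// addr_gt0// mulr_gt0.
move=> z; have [a [b [Na zab bN]]] := split_ker z.
have Nb : N b = N z by rewrite zab addrC seminormD_kernel.
have ib : `|iota b| <= k1 * N z.
  rewrite (le_trans (hi b))// /k1 -mulrA ler_pM2l// ler_pdivlMl// -Nb//.
have ia : `|iota a| <= c3^-1 * (`|K (iota z)| + kK * (k1 * N z)).
  rewrite ler_pdivlMl// (le_trans (K_ker Na))//.
  have -> : K (iota a) = K (iota z) - K (iota b).
    by rewrite -linearB -linearB zab addrK.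
  rewrite (le_trans (ler_normB _ _))// lerD2l (le_trans (hKb _))//.
  by rewrite ler_pM2l.
rewrite {1}zab linearD (le_trans (ler_normD _ _))//.
have Nz : 0 <= N z by have [h _ _] := semiN.
have Kz : 0 <= `|K (iota z)| := normr_ge0 _.
apply: (le_trans (lerD ia ib)).
have : 0 <= k1 * `|K (iota z)| by rewrite mulr_ge0// ltW.
have : 0 <= c3^-1 * N z by rewrite mulr_ge0 ?invr_ge0// ltW.
have : 0 <= c3^-1 * (kK * k1) * `|K (iota z)|.
  by rewrite mulr_ge0 ?mulr_ge0 ?invr_ge0// ltW.
lra.
Qed.

Section Minimizer.
Variable zs : Z.
Hypothesis zs_min : forall z, J zs <= J z.

Let ys := K (iota zs) - f.

(** Optimality makes [zeta], the composition of [- frechet F (iota zs)] with [iota], a subgradient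
    of [phi]; the linear terms of the two Bregman distances then cancel. *)
Lemma minimizer_bregman_split : exists (xi : dual Y) (zeta : dual Z),
  [/\ forall y, xi y <= `|y|, xi ys = `|ys|,
      subdifferential phi zs zeta &
      forall z, J z - J zs = (phi z - phi zs - zeta (z - zs)) +
        (`|K (iota z) - f| `^ r / r - `|ys| `^ r / r -
          `|ys| `^ (r - 1) * xi (K (iota (z - zs))))].
Proof.
have [xi xi1 xiu] := norming_functional ys.
have FE := discrepancy_frechet smoothY p1 pr cK xi1 xiu.
rewrite -/F in FE.
pose h z := - frechet F (iota zs) (iota z).
have lh : linear h.
  move=> a x y; rewrite /h linearP.
  have -> : frechet F (iota zs) (a *: iota x + iota y) =
      a * frechet F (iota zs) (iota x) + frechet F (iota zs) (iota y).
    exact: linearP.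
  by rewrite opprD -mulrN.
have [ki ki0 hi] := continuous_linear_bound ciota.
have [z|zeta zetaE] := @dual_of_bounded _ _ h (`|frechet F (iota zs)| * ki) lh.
  rewrite /h -linearN (le_trans (dual_ler_norm _ _))// normrN -mulrA.
  by rewrite ler_wpM2l.
exists xi, zeta; split => // [z|z].
  rewrite zetaE /h.
  by apply: (minimizer_subgradient (discrepancy_frechet_expansion _)
    seminorm_penalty_convex zs_min).
by rewrite zetaE /h FE /J /F /discrepancy -/ys; lra.
Qed.

Hypothesis tcN : totally_convex phi N.
Hypothesis tcY :
  totally_convex (fun y : Y => `|y| `^ r / r) (fun y : Y => `|y|).

Lemma minimizing_sequence_cvg (v : nat -> Z) :
  J (v n) @[n --> \oo] --> J zs ->
  [/\ N (v n - zs) @[n --> \oo] --> (0 : R),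
      `|K (iota (v n - zs))| @[n --> \oo] --> (0 : R) &
      iota (v n) @[n --> \oo] --> iota zs].
Proof.
move=> Jv; have [xi [zeta [xi1 xis zetaP split]]] := minimizer_bregman_split.
pose w := `|ys| `^ (r - 1) *: xi.
have wP := power_norm_subdifferential (ltW r1) xi1 xis.
have KE z : K (iota (z - zs)) = K (iota z) - f - ys.
  by rewrite /ys opprB addrA subrK !linearB.
have wE z : `|ys| `^ (r - 1) * xi (K (iota (z - zs))) = w (K (iota z) - f - ys).
  by rewrite KE.
pose B1 n := phi (v n) - phi zs - zeta (v n - zs).
pose B2 n := `|K (iota (v n)) - f| `^ r / r - `|ys| `^ r / r -
  w (K (iota (v n)) - f - ys).
have B10 n : 0 <= B1 n by have := zetaP (v n); rewrite /B1; lra.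
have B20 n : 0 <= B2 n.
  by have := wP (K (iota (v n)) - f); rewrite /B2 -/w; lra.
have B12 n : J (v n) - J zs = B1 n + B2 n by rewrite split wE.
have J0 : J (v n) - J zs @[n --> \oo] --> (0 : R).
  by rewrite -(subrr (J zs)); apply: cvgB => //; exact: cvg_cst.
have B1c : B1 n @[n --> \oo] --> (0 : R).
  apply: squeeze_cvgr (cvg_cst 0) J0; near=> n.
  by rewrite B10 B12 lerDl B20.
have B2c : B2 n @[n --> \oo] --> (0 : R).
  apply: squeeze_cvgr (cvg_cst 0) J0; near=> n.
  by rewrite B20 B12 lerDr B10.
have c1' := tcN zetaP B1c.
have c2' := tcY wP B2c.
have {}c2' : `|K (iota (v n - zs))| @[n --> \oo] --> (0 : R).
  by under eq_fun do rewrite KE.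
split => //; apply/cvgrPdist_le => e e0; have [k k0 hk] := embedding_bound.
have ek : 0 < e / k / 2 by rewrite !divr_gt0.
move/cvgrPdist_le/(_ _ ek) : c1' => c1'.
move/cvgrPdist_le/(_ _ ek) : c2' => c2'.
near=> n.
rewrite distrC -linearB (le_trans (hk _))// -ler_pdivlMl// mulrC.
have : `|0 - N (v n - zs)| <= e / k / 2 by near: n.
have : `|0 - `|K (iota (v n - zs))| | <= e / k / 2 by near: n.
rewrite !sub0r !normrN normr_id => h1 h2.
by have := ler_norm (N (v n - zs)); lra.
Unshelve. all: by end_near. Qed.

(** A second minimizer is a constant minimizing sequence, so it must agree with its limit. *)
Lemma minimizer_unique z : J z = J zs -> iota z = iota zs.
Proof.
move=> Jz; have [|_ _ h] := @minimizing_sequence_cvg (fun=> z).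
  by rewrite Jz; exact: cvg_cst.
by rewrite -(cvg_lim (@norm_hausdorff _ _) h) lim_cst//; exact: norm_hausdorff.
Qed.

Lemma minimizing_sequence_rate (q c : R) (v : nat -> Z) :
  r <= q -> s <= q -> 2 <= q ->
  convex_power_type_at q N zs -> convex_power_type Y q ->
  J (v n) @[n --> \oo] --> J zs ->
  0 < c -> (forall n, (0 < n)%N -> J (v n) - J zs <= c * n%:R `^ (1 - p)) ->
  (fun n => `|iota (v n) - iota zs|) =O_\oo (fun n => n%:R `^ ((1 - p) / q)).
Proof.
move=> rq sq q2 convN convY Jv c0 Jrate; have q0 : 0 < q by lra.
have [cN0 cK0 _] := minimizing_sequence_cvg Jv.
have [xi [zeta [xi1 xis zetaP split]]] := minimizer_bregman_split.
have [cN [dN [cNp dNp hN]]] :=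
  power_seminorm_growth semiN a0 s1 sq q2 c10 split_ker zetaP tcN convN.
have [cY [dY [cYp dYp hY]]] := power_norm_growth convY r1 rq q2 xi1 xis.
have [k k0 hk] := embedding_bound.
pose m := Num.min cN cY; have m0 : 0 < m by rewrite lt_min cNp.
pose M := (k * 2) `^ q / m * c.
have k2 : 0 < (k * 2) `^ q by rewrite powR_gt0// mulr_gt0.
have M0 : 0 < M by rewrite mulr_gt0// divr_gt0.
apply/eqO_exP; exists (M `^ q^-1); first exact: powR_gt0.
(* Both growth estimates are local; the convergence already established brings large [n] into their
   range. *)
move/cvgrPdist_le/(_ _ dNp) : cN0 => cN0.
move/cvgrPdist_le/(_ _ dYp) : cK0 => cK0.
near=> n.
have n0 : (0 < n)%N by near: n; exists 1%N.
have : `|0 - N (v n - zs)| <= dN by near: n.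
have : `|0 - `|K (iota (v n - zs))| | <= dY by near: n.
rewrite !sub0r !normrN normr_id => hd2 hd1.
set A := N (v n - zs) in hd1 *; set B := `|K (iota (v n - zs))| in hd2 *.
have A0 : 0 <= A by have [h _ _] := semiN; exact: h.
have B0 : 0 <= B := normr_ge0 _.
rewrite ger0_norm// in hd1.
have KE z : K (iota (z - zs)) = K (iota z) - f - ys.
  by rewrite /ys opprB addrA subrK !linearB.
have g1 := hN _ hd1.
have := hY (K (iota (v n)) - f); rewrite -/ys -KE => /(_ hd2) g2.
have g3 := split (v n).
have gap : m * (A `^ q + B `^ q) <= J (v n) - J zs.
  rewrite g3 mulrDr lerD//.
    by rewrite (le_trans _ g1)// ler_wpM2r ?powR_ge0// ge_min lexx.
  by rewrite (le_trans _ g2)// ler_wpM2r ?powR_ge0// ge_min lexx orbT.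
have AB0 : 0 <= A `^ q + B `^ q by rewrite addr_ge0 ?powR_ge0.
have h1 : `|iota (v n - zs)| `^ q <= M * n%:R `^ (1 - p).
  apply: (le_trans (ler_powR_base (ltW q0) (normr_ge0 _) (hk _))).
  rewrite -/A -/B (powRM _ (ltW k0) (addr_ge0 A0 B0)).
  have /(ler_wpM2l (powR_ge0 k q)) := powRD_le A0 B0 (ltW q0).
  rewrite mulrA -(powRM _ (ltW k0) (ler0n _ 2)) => /le_trans; apply.
  have -> : M * n%:R `^ (1 - p) = (k * 2) `^ q * ((c * n%:R `^ (1 - p)) / m).
    by rewrite /M; ring.
  rewrite ler_pM2l// ler_pdivlMr// mulrC (le_trans gap)// Jrate//.
rewrite -linearB normr_id [X in _ <= _ * X]ger0_norm ?powR_ge0//.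
have iq : 0 <= q^-1 by rewrite invr_ge0 ltW.
have := ler_powR_base iq (powR_ge0 _ _) h1.
by rewrite -powRrM mulfV ?gt_eqF// powRr1// powRM ?(ltW M0) ?powR_ge0// -powRrM.
Unshelve. all: by end_near. Qed.

End Minimizer.
End Tikhonov.


Theorem theorem3 (R : realType) (X Y Z : completeNormedModType R)
    (K : {linear X -> Y}) (f : Y) (r s alpha : R)
    (iota : {linear Z -> X}) (N : Z -> R) (Z1 : set Z)
    (p delta tau0 : R) (C L tau : nat -> R) (u : nat -> X) :
  let Z0 := [set z : Z | N z = 0] in
  let F := discrepancy K f r in
  let Phi := penalty iota N s alpha in
  reflexive_space X ->
  continuous K ->
  1 < r -> 1 <= s -> 0 < alpha ->
  injective iota -> continuous iota ->
  is_seminorm N ->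
  closed_subspace Z0 -> closed_subspace Z1 -> direct_sum Z0 Z1 ->
  closed (iota @` Z0) ->
  (exists c1 c2 : R, [/\ 0 < c1, 0 < c2 &
     forall z, Z1 z -> c1 * `|z| <= N z <= c2 * `|z|]) ->
  (exists2 c : R, 0 < c &
     forall z, Z0 z -> c * `|iota z| <= `|K (iota z)|) ->
  lower_semicontinuous Phi ->
  1 < p <= 2 -> p <= r ->
  smooth_power_type Y p ->
  totally_convex (fun z : Z => alpha * (N z `^ s / s)) N ->
  totally_convex (fun y : Y => `|y| `^ r / r) (fun y : Y => `|y|) ->
  0 < delta < 1 -> 0 < tau0 ->
  forward_backward p delta tau0 F Phi C L tau u ->
  exists zstar : Z,
    [/\ argmin (objective F Phi) = [set iota zstar],
        u n @[n --> \oo] --> iota zstar &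
        forall q : R, Num.max r (Num.max s 2) <= q ->
          convex_power_type_at q N zstar ->
          convex_power_type Y q ->
          (fun n => `|u n - iota zstar|)
            =O_\oo (fun n => n%:R `^ ((1 - p) / q))].
Proof.
move=> Z0 F Phi reflX cK r1 s1 a0 iotaI ciota semiN _ _ [dec _] _.
move=> [c1 [c2 [c10 _ Z1eq]]] [c3 c30 K_inv] lscPhi p12 pr smoothY tcN tcY d01 t0 fb.
have /andP[p1 p2] := p12.
have split_ker z : exists a b, [/\ N a = 0, z = a + b & c1 * `|b| <= N b].
  have [a [b [Z0a Z1b ->]]] := dec z; exists a, b; split => //.
  by have /andP[] := Z1eq _ Z1b.
have F_sub := discrepancy_frechet_subgradient f cK p1 pr smoothY.
have F_exp := discrepancy_frechet_expansion f cK p1 pr smoothY.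
have Phi0 := penalty_ge0 N s1 a0 iotaI; rewrite -/Phi in Phi0.
have Phi_conv := penalty_convex s1 a0 iotaI semiN.
have Phiu n := forward_backward_finite Phi0 t0 fb n.
have objE := objective_range K f r s alpha N iotaI.
have [x xmin] : argmin (objective F Phi) !=set0.
  (* Boundedness of the sublevel set of [u 0] is part of the iteration data: it is the first ball,
     of radius [C 0]. *)
  apply: (@reflexive_argmin_nonempty _ _ _ (u 0%N) (C 0%N)) => //.
  - exact: (objective_ge0 K f N s1 a0 iotaI p1 pr).
  - exact: (objective_sublevel_convex cK s1 a0 iotaI semiN p1 pr smoothY).
  - apply: lower_semicontinuousD_continuous => //.
    exact: continuous_of_expansion F_sub F_exp.
  - have [z uz] := penalty_finite (Phiu 0%N).
    by rewrite uz objE ltry.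
  - by case: fb => _ ballC _ _ _ _ _; exact: ballC.
have [zs xzs] : exists z, x = iota z.
  have [z uz] := penalty_finite (Phiu 0%N).
  by have := xmin (u 0%N); rewrite uz objE => /objective_finite.
subst x.
pose J z := discrepancy K f r (iota z) + alpha * (N z `^ s / s).
have zs_min z : J zs <= J z by have := xmin (iota z); rewrite !objE lee_fin.
have [z uz] := choice (fun n => penalty_finite (Phiu n)).
have Phizs : (Phi (iota zs) < +oo)%E by rewrite /Phi penalty_range// ltry.
have [c c0 rate] := forward_backward_rate p12 F_sub F_exp Phi0 Phi_conv d01 t0 fb
  xmin Phizs.
have Jrate n : (0 < n)%N -> J (z n) - J zs <= c * n%:R `^ (1 - p).
  by move=> n0; have := rate n n0; rewrite /= uz /Phi !(penalty_range s alpha N iotaI).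
have Jz : J (z n) @[n --> \oo] --> J zs.
  apply/subr_cvg0.
  apply: (@squeeze_cvgr _ _ _ _ (fun=> 0) (fun n => c * n%:R `^ (1 - p))).
  - near=> k; rewrite subr_ge0 zs_min Jrate//.
    by near: k; exists 1%N.
  - exact: cvg_cst.
  - rewrite -(mulr0 c); apply: cvgM; first exact: cvg_cst.
    by apply: cvg_natr_powR0; lra.
have uE : u = iota \o z by apply/funext.
exists zs; split.
- apply/seteqP; split => [y ymin|_ -> //].
  have : (objective F Phi y <= (J zs)%:E)%E by rewrite -objE; exact: ymin.
  move=> /[dup] /objective_finite[w ->]; rewrite objE lee_fin => Jw.
  apply: (minimizer_unique cK s1 a0 ciota semiN c10 c30 split_ker K_inv p1 pr
    smoothY zs_min tcN tcY).
  by apply/eqP; rewrite eq_le Jw zs_min.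
- rewrite uE.
  by have [] := minimizing_sequence_cvg cK s1 a0 ciota semiN c10 c30 split_ker
    K_inv p1 pr smoothY zs_min tcN tcY Jz.
- move=> q; rewrite !ge_max => /and3P[rq sq q2] convN convY; rewrite uE.
  exact: (minimizing_sequence_rate cK s1 a0 ciota semiN c10 c30 split_ker
    K_inv p1 pr smoothY zs_min tcN tcY rq sq q2 convN convY Jz c0 Jrate).
Unshelve. all: by end_near. Qed.
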